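(* Let $M\in\mathbb{R}^{m\times n}$, let $1\le r\le\min\{m,n\}$, and let $$M=\begin{bmatrix}U^{(r)} & U_\perp\end{bmatrix}\begin{bmatrix}\Sigma^{(r)} & \\ & \Sigma_\perp\end{bmatrix}\begin{bmatrix}V^{(r)T}\\ V_\perp^T\end{bmatrix}$$ be the SVD of $M$, where $\Sigma^{(r)}=\operatorname{diag}(\sigma_1(M),\dots,\sigma_r(M))$. Assume $\sigma_r(M)>\sigma_{r+1}(M)>0$ and $$\frac{\sigma_{r+1}(M)}{\sigma_r(M)}\le\frac12,\qquad A_0\in\mathbb{R}^{m\times r},\qquad \operatorname{Dist}(A_0,U^{(r)})\le\frac12 .$$ Put $\theta:=\dfrac{\|M-M_r\|_F}{\sigma_{r+1}(M)}$. Fix positive numbers $\xi<1/3$ and $\epsilon\le(8\theta)^{-2}$ and a real $\beta$ with $0<\beta\le1$, put $l=\lceil1296\,\beta^{-1}r^2\epsilon^{-2}\xi^{-4}\rceil$, and assume $l\le\min\{m,n\}$. Let the Randomized Iterative Refinement algorithm (described in the context) be applied to $M$, $A_0$, $\epsilon$, $\xi$, $\beta$ with $$\tau=\left\lceil\tfrac12\log_{0.87}(8\theta\epsilon)\right\rceil$$ iterations. Then its output matrix $A_\tau$ satisfies $$\operatorname{Dist}(A_\tau,U^{(r)})\le4\theta\sqrt{\epsilon}$$ with probability no less than $1-2\tau\xi$.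
   Context: All matrices are real. $\sigma_j(M)$ is the $j$-th largest singular value of $M$; $\|\cdot\|$ is the spectral norm, $\|\cdot\|_F$ the Frobenius norm; $W^+$ is the Moore–Penrose pseudoinverse. $M_r=U^{(r)}\Sigma^{(r)}V^{(r)T}$ is the $r$-truncation of $M$ (all singular values but the $r$ largest set to $0$). Principal Angle Distance. For two subspaces $E_1,E_2$ of the same dimension in $\mathbb{R}^k$, let $G,H$ be matrices with orthonormal columns spanning $E_1,E_2$, and $G_\perp,H_\perp$ matrices with orthonormal columns spanning their orthogonal complements; then $\operatorname{Dist}(E_1,E_2):=\|G_\perp^TH\|=\|H_\perp^TG\|$. If the dimensions differ, $\operatorname{Dist}(E_1,E_2)=1$. For matrices, $\operatorname{Dist}(G,H)$ means $\operatorname{Dist}(\operatorname{range}(G),\operatorname{range}(H))$. Leverage scores. For a $g\times h$ matrix $W$ with $\sigma_r(W)>\sigma_{r+1}(W)$ (with $\sigma_{r+1}(W)=0$ if $r=\min\{g,h\}$) and with $U_W^{(r)}=(u_{i,j})$, $V_W^{(r)}=(v_{i,j})$ the matrices of its top $r$ left and right singular vectors, the rank-$r$ row leverage scores are $\tilde\gamma_i=\sum_{j=1}^ru_{i,j}^2$ ($i=1,\dots,g$) and the rank-$r$ column leverage scores are $\gamma_i=\sum_{j=1}^rv_{i,j}^2$ ($i=1,\dots,h$). Exactly($l$) sampling and scaling. Input: integers $1\le l\le k$ and positive $p_1,\dots,p_k$ with $\sum_ip_i=1$. Start with zero matrices $\widehat S\in\mathbb{R}^{k\times l}$, $\widehat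 D\in\mathbb{R}^{l\times l}$. For $t=1,\dots,l$: draw independently a random $N\in\{1,\dots,k\}$ with $\operatorname{Prob}\{N=i\}=p_i$, set $\widehat s_{N,t}=1$ and $\widehat d_{t,t}=1/\sqrt{l\,p_N}$. Output the $l\times k$ sampling and scaling matrix $\mathcal S=(\widehat S\widehat D)^T$. Randomized Iterative Refinement algorithm. Input: $M\in\mathbb{R}^{m\times n}$, $A_0\in\mathbb{R}^{m\times r}$, positive integer $\tau$, $\epsilon$, $\xi$, $\beta\in(0,1]$; $l$ as in the claim. For $t=0,1,\dots,\tau-1$: 1. compute the rank-$r$ row leverage scores $\tilde\gamma_i$ of $A_t$ and probabilities $\tilde p_i>0$, $\tilde p_i\ge\beta\tilde\gamma_i/r$, $\sum_{i=1}^m\tilde p_i=1$; 2. apply Exactly($l$) to $\tilde p_1,\dots,\tilde p_m$ to get $\mathcal S$ (of size $l\times m$); 3. set $B_{t+1}=(\mathcal SA_t)^+\mathcal SM$; 4. compute the rank-$r$ column leverage scores $\gamma_i$ of $B_{t+1}$ and probabilities $p_i>0$, $p_i\ge\beta\gamma_i/r$, $\sum_{i=1}^np_i=1$; 5. apply Exactly($l$), with fresh independent randomness, to $p_1,\dots,p_n$ to get a new $\mathcal S$ (of size $l\times n$); 6. set $A_{t+1}=M\mathcal S^T(B_{t+1}\mathcal S^T)^+$. Output: $A_\tau$, $B_\tau$. A run in which some $A_t$ or $B_{t+1}$ has rank less than $r$, so that its rank-$r$ leverage scores are undefined, is counted as a failure. *)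

(* Defs.v *)
From HB Require Import structures.
From mathcomp Require Import all_boot all_order all_algebra.
From mathcomp Require Import all_classical all_reals all_analysis.
Set Implicit Arguments.
Unset Strict Implicit.
Unset Printing Implicit Defensive.
Import Order.TTheory GRing.Theory Num.Theory.
Local Open Scope classical_set_scope.
Local Open Scope ring_scope.

(* The norm that MathComp-Analysis puts on matrices is the max norm, so the
   Frobenius and spectral norms are defined here.  On column vectors [fnorm] is
   the Euclidean norm. *)
Definition fnorm (R : realType) (m n : nat) (A : 'M[R]_(m, n)) : R :=
  Num.sqrt (\sum_(i < m) \sum_(j < n) A i j ^+ 2).

Definition spectral_norm (R : realType) (m n : nat) (A : 'M[R]_(m, n)) : R :=
  sup [set fnorm (A *m x) | x in [set x : 'cV[R]_n | fnorm x <= 1]].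

(* Sequences of singular values are indexed from 1, as sigma_j is; the value
   at index 0 is never used. *)
Definition svd_diag (R : realType) (m n : nat) (s : nat -> R) : 'M[R]_(m, n) :=
  \matrix_(i < m, j < n) (s i.+1 *+ (i == j :> nat)).

Definition is_svd (R : realType) (m n : nat) (M : 'M[R]_(m, n))
    (U : 'M[R]_m) (s : nat -> R) (V : 'M[R]_n) : Prop :=
  [/\ U^T *m U = 1%:M,
      V^T *m V = 1%:M &
      M = U *m svd_diag m n s *m V^T] /\
  [/\ (forall j, 0 <= s j),
      (forall i j, (0 < i <= j)%N -> s j <= s i) &
      (forall j, (minn m n < j)%N -> s j = 0)].

(* Every real matrix has an SVD, so the default value is never returned. *)
Definition svd (R : realType) (m n : nat) (M : 'M[R]_(m, n)) :
    'M[R]_m * (nat -> R) * 'M[R]_n :=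
  xget (0, fun=> 0, 0) [set T | is_svd M T.1.1 T.1.2 T.2].

Definition sing_val (R : realType) (m n : nat) (M : 'M[R]_(m, n)) : nat -> R :=
  (svd M).1.2.

(* The first r columns of U (for r <= k). *)
Definition top_cols (R : realType) (k r : nat) (U : 'M[R]_k) : 'M[R]_(k, r) :=
  U *m pid_mx r.

Definition truncation (R : realType) (m n r : nat)
    (U : 'M[R]_m) (s : nat -> R) (V : 'M[R]_n) : 'M[R]_(m, n) :=
  U *m svd_diag m n (fun j => if (j <= r)%N then s j else 0) *m V^T.

(* When sigma_r(W) > sigma_{r+1}(W), as is required for leverage scores to be
   defined, the sums below do not depend on the SVD chosen. *)
Definition row_leverage (R : realType) (g h r : nat) (W : 'M[R]_(g, h))
    (i : 'I_g) : R :=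
  \sum_(j < r) top_cols r (svd W).1.1 i j ^+ 2.

Definition col_leverage (R : realType) (g h r : nat) (W : 'M[R]_(g, h))
    (i : 'I_h) : R :=
  \sum_(j < r) top_cols r (svd W).2 i j ^+ 2.

Definition is_pseudoinverse (R : realType) (m n : nat)
    (W : 'M[R]_(m, n)) (X : 'M[R]_(n, m)) : Prop :=
  [/\ W *m X *m W = W,
      X *m W *m X = X,
      (W *m X)^T = W *m X &
      (X *m W)^T = X *m W].

(* MathComp's [pinvmx] is only some partial inverse, not the Moore-Penrose
   one. *)
Definition pseudoinverse (R : realType) (m n : nat) (W : 'M[R]_(m, n)) :
    'M[R]_(n, m) :=
  xget 0 [set X | is_pseudoinverse W X].

(* Ranges are column spaces here, while the %MS operations are about row
   spaces; hence the transpositions. *)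
Definition orth_basis (R : realType) (k d : nat) (E : 'M[R]_(k, d)) :
    'M[R]_(k, \rank E) :=
  xget 0 [set G : 'M[R]_(k, \rank E) |
    G^T *m G = 1%:M /\ (G^T == E^T)%MS].

(* A matrix whose range is the orthogonal complement of the range of E. *)
Definition orth_compl (R : realType) (k d : nat) (E : 'M[R]_(k, d)) :
    'M[R]_k :=
  (kermx E)^T.

(* Principal angle distance between the ranges of E1 and E2. *)
Definition Dist (R : realType) (k d1 d2 : nat)
    (E1 : 'M[R]_(k, d1)) (E2 : 'M[R]_(k, d2)) : R :=
  if \rank E1 == \rank E2 then
    spectral_norm ((orth_basis (orth_compl E1))^T *m orth_basis E2)
  else 1.

Definition is_pos_distr (R : realType) (k : nat) (p : 'I_k -> R) : Prop :=
  (forall i, 0 < p i) /\ \sum_(i < k) p i = 1.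

(* Exactly(l) is split into its l independent draws N, the probability of
   drawing N, and the l x k sampling and scaling matrix computed from N. *)
Definition draws (l k : nat) := {ffun 'I_l -> 'I_k}.

Definition draws_prob (R : realType) (l k : nat) (p : 'I_k -> R)
    (N : draws l k) : R :=
  \prod_(t < l) p (N t).

Definition sampling_mx (R : realType) (l k : nat) (p : 'I_k -> R)
    (N : draws l k) : 'M[R]_(l, k) :=
  let S : 'M[R]_(k, l) := \matrix_(i < k, t < l) (N t == i)%:R in
  let D : 'M[R]_l := diag_mx (\row_(t < l) (Num.sqrt (l%:R * p (N t)))^-1) in
  (S *m D)^T.

(* One iteration of the algorithm draws rows of M, then columns of M. *)
Definition round (m n l : nat) := (draws l m * draws l n)%type.

(* A history is the list of the rounds already made, most recent first.  The
   algorithm does not fix how the sampling probabilities are computed, only the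
   constraints on them, so they are given by two arbitrary functions:
   [rowp h] is the distribution of the row draws that follow the history h, and
   [colp h N] that of the column draws made when, after h, the row draws of the
   current iteration are N. *)
Section RandomizedIterativeRefinement.
Variables (R : realType) (m n r l : nat).
Variables (M : 'M[R]_(m, n)) (A0 : 'M[R]_(m, r)).
Variable rowp : seq (round m n l) -> 'I_m -> R.
Variable colp : seq (round m n l) -> draws l m -> 'I_n -> R.

Definition next_B (h : seq (round m n l)) (A : 'M[R]_(m, r)) (N : draws l m) :
    'M[R]_(r, n) :=
  let S := sampling_mx (rowp h) N in
  pseudoinverse (S *m A) *m (S *m M).

Definition next_A (h : seq (round m n l)) (N : draws l m) (B : 'M[R]_(r, n))
    (N' : draws l n) : 'M[R]_(m, r) :=
  let S := sampling_mx (colp h N) N' in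
  M *m S^T *m pseudoinverse (B *m S^T).

(* The matrix A_t after a history of length t. *)
Fixpoint iter_A (h : seq (round m n l)) : 'M[R]_(m, r) :=
  match h with
  | [::] => A0
  | w :: h' => next_A h' w.1 (next_B h' (iter_A h') w.1) w.2
  end.

(* The matrix B_{t+1} computed after a history of length t and the row draws N
   of the next iteration. *)
Definition iter_B (h : seq (round m n l)) (N : draws l m) : 'M[R]_(r, n) :=
  next_B h (iter_A h) N.

Fixpoint run_prob (h : seq (round m n l)) : R :=
  match h with
  | [::] => 1
  | w :: h' =>
      run_prob h' * draws_prob (rowp h') w.1 * draws_prob (colp h' w.1) w.2
  end.

(* All the leverage scores needed in the run were defined. *)
Fixpoint no_failure (h : seq (round m n l)) : bool :=
  match h with
  | [::] => true
  | w :: h' =>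
      [&& no_failure h', \rank (iter_A h') == r & \rank (iter_B h' w.1) == r]
  end.

(* The constraints on the sampling probabilities in the first tau iterations.
   After a failure the distributions are arbitrary: they only serve to keep the total
   mass of [run_prob] equal to 1. *)
Definition admissible (tau : nat) (beta : R) : Prop :=
  forall h : seq (round m n l), (size h < tau)%N ->
    [/\ is_pos_distr (rowp h),
        \rank (iter_A h) = r ->
          forall i, beta * row_leverage r (iter_A h) i / r%:R <= rowp h i &
        forall N : draws l m,
          is_pos_distr (colp h N) /\
          (\rank (iter_B h N) = r ->
             forall i,
               beta * col_leverage r (iter_B h N) i / r%:R <= colp h N i)].

(* The probability that a run of tau iterations does not fail and that its
   output A_tau satisfies Q. *)
Definition prob_output (tau : nat) (Q : 'M[R]_(m, r) -> bool) : R :=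
  \sum_(w : tau.-tuple (round m n l) | no_failure w && Q (iter_A w)) run_prob w.

End RandomizedIterativeRefinement.

(* Main.v *)
Require Import Defs.
From HB Require Import structures.
From mathcomp Require Import all_boot all_order all_algebra.
From mathcomp Require Import all_classical all_reals all_analysis.
From mathcomp Require Import ring lra zify.
Set Implicit Arguments.
Unset Strict Implicit.
Unset Printing Implicit Defensive.
Import Order.TTheory GRing.Theory Num.Theory.
Import numFieldNormedType.Exports.
Local Open Scope ring_scope.

(** Half an iteration replaces a matrix [A], whose range is close to that of the
    leading left singular vectors [U1] of [M], by a sketched least squares
    solution, whose row space is close to that of the leading right singular
    vectors [V1]; the other half is the same for the transpose of [M].  So one
    half iteration has to be understood, and it has to be shown that it
    contracts the distance with probability at least 1 - xi.

    Let [Q] be an orthonormal basis of the range of [A], [S] the sampling matrix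
    and [Y = Q^T S^T S].  By the normal equations the solution [(S A)^+ S M] has
    the row space of [Y M] ([sketched_solution]).  Write [M = U1 D V1^T + E] with
    [E] the residual of the truncation.  Then [Y M = K V1^T + Y E], where
    [K = Y U1 D], and [E V1 = 0]: the tangent of the largest angle between the
    row space of [Y M] and the range of [V1] is the norm of [K^-1 Y E].  For
    [Y = Q^T] this is at most (sigma_(r+1) / sigma_r) tan(alpha), where alpha is
    the largest angle between the ranges of [Q] and [U1], because [U1^T E = 0];
    and that is at most 2/3 of the sine of alpha here.  The slack up to the
    factor 0.87 absorbs the errors [Y U1 - Q^T U1] and [Y E - Q^T E]
    ([near_perturbed]).

    These errors are small because [Y W] is an unbiased estimate of [Q^T W], for
    every [W], and sampling by leverage scores makes its mean square error at
    most r |W|_F^2 / (beta l) ([sketched_product_error]).  A single use of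
    Markov's inequality, for [W] made of [Q], [U1] and the normalised [E], gives
    [Y Q] invertible and both errors small at once ([sampled_half_step]).

    The error [Y E - Q^T E] is of the order of eps times the Frobenius norm of
    [E], hence the distances decrease geometrically down to the level
    eps theta.  After 2 tau half iterations they are at most 4 theta eps, which
    is below 4 theta sqrt eps.  The draws of a half iteration are fresh given the past,
    so all half iterations succeed with probability at least (1 - 2 xi)^tau >= 1 - 2 tau xi
    ([run_prob_chain]).

    Leverage scores and principal angles refer to singular value decompositions
    and orthonormal bases, whose existence is proved first, from the compactness
    of the unit sphere ([exists_svd]). *)

(** * Frobenius and spectral norms *)

Section Norm.
Variable R : realType.

Definition mxdot m n (A B : 'M[R]_(m, n)) : R := \tr (A^T *m B).

Lemma mxdotE m n (A B : 'M[R]_(m, n)) :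
  mxdot A B = \sum_i \sum_j A i j * B i j.
Proof.
rewrite /mxdot /mxtrace exchange_big /=; apply: eq_bigr => j _.
by rewrite mxE; apply: eq_bigr => i _; rewrite mxE.
Qed.

Lemma mxdotC m n (A B : 'M[R]_(m, n)) : mxdot A B = mxdot B A.
Proof. by rewrite /mxdot -mxtrace_tr trmx_mul trmxK. Qed.

Lemma mxdotDl m n (A B C : 'M[R]_(m, n)) :
  mxdot (A + B) C = mxdot A C + mxdot B C.
Proof. by rewrite /mxdot linearD /= mulmxDl mxtraceD. Qed.

Lemma mxdotZl m n a (A B : 'M[R]_(m, n)) : mxdot (a *: A) B = a * mxdot A B.
Proof. by rewrite /mxdot linearZ /= -scalemxAl mxtraceZ. Qed.

Lemma mxdotDr m n (A B C : 'M[R]_(m, n)) :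
  mxdot C (A + B) = mxdot C A + mxdot C B.
Proof. by rewrite !(mxdotC C) mxdotDl. Qed.

Lemma mxdotZr m n a (A B : 'M[R]_(m, n)) : mxdot A (a *: B) = a * mxdot A B.
Proof. by rewrite !(mxdotC A) mxdotZl. Qed.

Lemma mxdot_mull m n p (Q : 'M[R]_(p, m)) (A : 'M[R]_(m, n)) (B : 'M[R]_(p, n)) :
  mxdot (Q *m A) B = mxdot A (Q^T *m B).
Proof. by rewrite /mxdot trmx_mul mulmxA. Qed.

Lemma fnorm_ge0 m n (A : 'M[R]_(m, n)) : 0 <= fnorm A.
Proof. exact: sqrtr_ge0. Qed.

Lemma sqr_fnormE m n (A : 'M[R]_(m, n)) :
  fnorm A ^+ 2 = \sum_i \sum_j A i j ^+ 2.
Proof.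
by rewrite sqr_sqrtr // sumr_ge0 // => i _; rewrite sumr_ge0 // => j _; rewrite sqr_ge0.
Qed.

Lemma sqr_fnorm m n (A : 'M[R]_(m, n)) : fnorm A ^+ 2 = mxdot A A.
Proof.
rewrite sqr_fnormE mxdotE; apply: eq_bigr => i _.
by apply: eq_bigr => j _; rewrite expr2.
Qed.

Lemma fnorm_eq m n p q (A : 'M[R]_(m, n)) (B : 'M[R]_(p, q)) :
  mxdot A A = mxdot B B -> fnorm A = fnorm B.
Proof.
move=> AB; apply/eqP; rewrite -(@eqrXn2 _ 2) ?fnorm_ge0 //.
by rewrite !sqr_fnorm AB.
Qed.

Lemma fnorm_le_sqr m n (A : 'M[R]_(m, n)) c :
  0 <= c -> (fnorm A <= c) = (fnorm A ^+ 2 <= c ^+ 2).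
Proof. by move=> c0; rewrite ler_pXn2r // nnegrE fnorm_ge0. Qed.

Lemma fnorm0 m n : fnorm (0 : 'M[R]_(m, n)) = 0.
Proof.
apply/eqP; rewrite -sqrf_eq0 sqr_fnormE.
by rewrite big1 // => i _; rewrite big1 // => j _; rewrite mxE expr0n.
Qed.

Lemma fnorm_eq0 m n (A : 'M[R]_(m, n)) : fnorm A = 0 -> A = 0.
Proof.
move/eqP; rewrite -sqrf_eq0 sqr_fnormE psumr_eq0; last first.
  by move=> i _; rewrite sumr_ge0 // => j _; rewrite sqr_ge0.
move=> /allP A0; apply/matrixP => i j; rewrite mxE.
have := A0 i (mem_index_enum i); rewrite /= psumr_eq0; last first.
  by move=> k _; rewrite sqr_ge0.
by move=> /allP /(_ j (mem_index_enum j)) /=; rewrite sqrf_eq0 => /eqP.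
Qed.

Lemma fnormZ m n a (A : 'M[R]_(m, n)) : fnorm (a *: A) = `|a| * fnorm A.
Proof.
apply/eqP; rewrite -(@eqrXn2 _ 2) ?mulr_ge0 ?fnorm_ge0 //.
by rewrite exprMn !sqr_fnorm mxdotZl mxdotZr mulrA -expr2 real_normK ?num_real.
Qed.

Lemma fnormN m n (A : 'M[R]_(m, n)) : fnorm (- A) = fnorm A.
Proof. by rewrite -scaleN1r fnormZ normrN normr1 mul1r. Qed.

Lemma fnorm_tr m n (A : 'M[R]_(m, n)) : fnorm A^T = fnorm A.
Proof. by apply: fnorm_eq; rewrite /mxdot trmxK mxtrace_mulC. Qed.

Lemma sqr_fnormD m n (A B : 'M[R]_(m, n)) :
  fnorm (A + B) ^+ 2 = fnorm A ^+ 2 + 2 * mxdot A B + fnorm B ^+ 2.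
Proof. by rewrite !sqr_fnorm mxdotDl !mxdotDr (mxdotC B A); ring. Qed.

Lemma mxdot_le m n (A B : 'M[R]_(m, n)) : mxdot A B <= fnorm A * fnorm B.
Proof.
have [/fnorm_eq0 ->|a0] := eqVneq (fnorm A) 0.
  by rewrite fnorm0 mul0r /mxdot trmx0 mul0mx mxtrace0.
have [/fnorm_eq0 ->|b0] := eqVneq (fnorm B) 0.
  by rewrite fnorm0 mulr0 /mxdot mulmx0 mxtrace0.
have ab : 0 < fnorm A * fnorm B by rewrite mulr_gt0 // lt_def ?a0 ?b0 fnorm_ge0.
(* Expand the square of | |B| A - |A| B |. *)
have := sqr_ge0 (fnorm (fnorm B *: A + (- fnorm A) *: B)).
rewrite sqr_fnormD !fnormZ normrN !ger0_norm ?fnorm_ge0 // mxdotZl mxdotZr.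
set a := fnorm A in ab *; set b := fnorm B in ab *; set c := mxdot A B => h.
have {}h : 0 <= (a * b) * (a * b - c) by nra.
by rewrite pmulr_rge0 // subr_ge0 in h.
Qed.

Lemma ler_fnormD m n (A B : 'M[R]_(m, n)) : fnorm (A + B) <= fnorm A + fnorm B.
Proof.
rewrite fnorm_le_sqr ?addr_ge0 ?fnorm_ge0 // sqr_fnormD.
by have := mxdot_le A B; nra.
Qed.

Lemma ler_fnormB m n (A B : 'M[R]_(m, n)) : fnorm A - fnorm B <= fnorm (A + B).
Proof.
have := ler_fnormD (A + B) (- B); rewrite addrK fnormN; lra.
Qed.

Lemma fnorm_isom m n p (Q : 'M[R]_(m, n)) (x : 'M[R]_(n, p)) :
  Q^T *m Q = 1%:M -> fnorm (Q *m x) = fnorm x.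
Proof.
by move=> QQ; apply: fnorm_eq; rewrite mxdot_mull mulmxA QQ mul1mx.
Qed.

Lemma sqr_fnorm_isom m n (Q : 'M[R]_(m, n)) :
  Q^T *m Q = 1%:M -> fnorm Q ^+ 2 = n%:R.
Proof. by move=> QQ; rewrite sqr_fnorm /mxdot QQ mxtrace1. Qed.

(** An upper bound for the spectral norm, in a form without suprema that
    composes well. *)
Definition opnorm_le m n (A : 'M[R]_(m, n)) (c : R) :=
  forall x : 'cV[R]_n, fnorm (A *m x) <= c * fnorm x.

Lemma opnorm_le_fnorm m n (A : 'M[R]_(m, n)) : opnorm_le A (fnorm A).
Proof.
move=> x; rewrite fnorm_le_sqr ?mulr_ge0 ?fnorm_ge0 // exprMn !sqr_fnormE.
rewrite mulr_suml; apply: ler_sum => i _; rewrite big_ord1.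
pose a := row i A.
have -> : (A *m x) i ord0 = mxdot a^T x.
  rewrite mxdotE mxE; apply: eq_bigr => j _.
  by rewrite big_ord1 !mxE.
have -> : \sum_j A i j ^+ 2 = fnorm a^T ^+ 2.
  rewrite fnorm_tr sqr_fnormE big_ord1; apply: eq_bigr => j _.
  by rewrite mxE.
have -> : \sum_i0 \sum_j x i0 j ^+ 2 = fnorm x ^+ 2 by rewrite sqr_fnormE.
rewrite -exprMn -ler_sqrt ?sqr_ge0 // !sqrtr_sqr [leRHS]ger0_norm; last first.
  by rewrite mulr_ge0 ?fnorm_ge0.
rewrite ler_norml mxdot_le andbT lerNl -mulN1r -mxdotZl.
by apply: le_trans (mxdot_le _ _) _; rewrite fnormZ normrN normr1 mul1r.
Qed.

Lemma opnorm_le_weaken m n (A : 'M[R]_(m, n)) c d : c <= d -> opnorm_le A c -> opnorm_le A d.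
Proof.
move=> cd Ac x; apply: le_trans (Ac x) _.
by rewrite ler_wpM2r ?fnorm_ge0.
Qed.

(** |A^T x|^2 = <A A^T x, x> <= c |A^T x| |x|. *)
Lemma opnorm_le_tr m n (A : 'M[R]_(m, n)) c : 0 <= c -> opnorm_le A c -> opnorm_le A^T c.
Proof.
move=> c0 Ac x.
have [->|y0] := eqVneq (fnorm (A^T *m x)) 0; first by rewrite mulr_ge0 ?fnorm_ge0.
have yp : 0 < fnorm (A^T *m x) by rewrite lt_def y0 fnorm_ge0.
rewrite -(ler_pM2l yp) -expr2 sqr_fnorm mxdot_mull trmxK mxdotC.
apply: le_trans (mxdot_le _ _) _.
rewrite mulrA; apply: ler_wpM2r; first exact: fnorm_ge0.
by rewrite mulrC; apply: Ac.
Qed.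

Lemma lower_bound_unit n (A : 'M[R]_n) c :
  0 < c -> (forall x : 'cV[R]_n, c * fnorm x <= fnorm (A *m x)) ->
  A \in unitmx.
Proof.
move=> c0 Ac; rewrite -unitmx_tr -row_free_unit; apply/inj_row_free => v vA.
have := Ac v^T; rewrite -[A]trmxK -trmx_mul vA trmx0 fnorm0 fnorm_tr.
rewrite pmulr_rle0 // => v0; apply: fnorm_eq0.
by apply/eqP; rewrite eq_le v0 fnorm_ge0.
Qed.

(** A lower bound c for a square matrix is the upper bound 1/c for its inverse,
    and upper bounds pass to the transpose. *)
Lemma lower_bound_tr n (A : 'M[R]_n) c :
  0 < c -> (forall x : 'cV[R]_n, c * fnorm x <= fnorm (A *m x)) ->
  forall x : 'cV[R]_n, c * fnorm x <= fnorm (A^T *m x).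
Proof.
move=> c0 Ac x; have Au := lower_bound_unit c0 Ac.
have /opnorm_le_tr : opnorm_le (invmx A) c^-1.
  move=> y; rewrite mulrC ler_pdivlMr // mulrC.
  by have := Ac (invmx A *m y); rewrite mulmxA mulmxV // mul1mx.
rewrite trmx_inv => /(_ _ (A^T *m x)); rewrite mulmxA mulVmx ?unitmx_tr //.
rewrite mul1mx => /(_ (ltW _)) h; rewrite mulrC -ler_pdivlMr // mulrC.
by apply: h; rewrite invr_gt0.
Qed.

Lemma spectral_norm_le m n (A : 'M[R]_(m, n)) c :
  0 <= c -> (spectral_norm A <= c) <-> opnorm_le A c.
Proof.
move=> c0; rewrite /spectral_norm; set E := (X in sup X).
have E0 : E !=set0%classic.
  by exists (fnorm (A *m (0 : 'cV[R]_n))), 0 => //=; rewrite fnorm0 ler01.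
split=> [h x|h]; last first.
  apply: ge_sup => // _ /= [x /= x1 <-].
  by apply: le_trans (h x) _; rewrite ler_piMr.
have [/fnorm_eq0 ->|x0] := eqVneq (fnorm x) 0.
  by rewrite mulmx0 !fnorm0 mulr0.
have xp : 0 < fnorm x by rewrite lt_def x0 fnorm_ge0.
rewrite -ler_pdivrMr //; apply: le_trans h.
apply: ub_le_sup.
  exists (fnorm A) => _ [y /= y1 <-].
  by apply: le_trans (opnorm_le_fnorm A y) _; rewrite ler_piMr ?fnorm_ge0.
exists ((fnorm x)^-1 *: x) => /=.
  by rewrite fnormZ ger0_norm ?invr_ge0 ?fnorm_ge0 // mulVf.
by rewrite -scalemxAr fnormZ ger0_norm ?invr_ge0 ?fnorm_ge0 // mulrC.
Qed.

End Norm.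

(** * Existence of singular value decompositions *)

Section SVD.
Variable R : realType.

Lemma continuous_sqr_mul n m (A : 'M[R]_(m, n)) :
  continuous (fun x : 'rV[R]_n => \sum_i (\sum_j A i j * x ord0 j) ^+ 2).
Proof.
apply: (continuous_big add_continuous) => i _ x.
apply: (@continuous_comp _ _ _ (fun x : 'rV[R]_n => \sum_j A i j * x ord0 j)
  (fun y : R => y ^+ 2)); last exact: exprn_continuous.
move: x; apply: (continuous_big add_continuous) => j _ x.
apply: continuousM; first exact: cst_continuous.
exact: coord_continuous.
Qed.

Lemma sqr_fnorm_mul_tr m n (A : 'M[R]_(m, n)) (x : 'rV[R]_n) :
  fnorm (A *m x^T) ^+ 2 = \sum_i (\sum_j A i j * x ord0 j) ^+ 2.
Proof.
rewrite sqr_fnormE; apply: eq_bigr => i _; rewrite big_ord1 mxE.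
by congr (_ ^+ 2); apply: eq_bigr => j _; rewrite mxE.
Qed.

(** The sphere is compact, so that the spectral norm of [A] is attained. *)
Lemma exists_max_vector m n (A : 'M[R]_(m, n.+1)) :
  exists2 v : 'cV[R]_n.+1, fnorm v = 1 & opnorm_le A (fnorm (A *m v)).
Proof.
pose S := [set x : 'rV[R]_n.+1 |
  \sum_i (\sum_j (1%:M : 'M[R]_n.+1) i j * x ord0 j) ^+ 2 = 1]%classic.
have SE x : S x <-> fnorm x = 1.
  rewrite /S /= -sqr_fnorm_mul_tr mul1mx fnorm_tr; split=> [/eqP|->].
    by rewrite -[X in _ == X](expr1n _ 2) eqrXn2 ?fnorm_ge0 // => /eqP.
  by rewrite expr1n.
have S0 : S !=set0%classic.
  exists (delta_mx 0 0); rewrite SE.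
  apply/eqP; rewrite -(@eqrXn2 _ 2) ?fnorm_ge0 // expr1n sqr_fnormE big_ord1.
  rewrite (bigD1 ord0) //= mxE !eqxx expr1n big1 ?addr0 // => j /negPf j0.
  by rewrite mxE j0 andbF expr0n.
have cS : compact S.
  apply: bounded_closed_compact.
    exists 1; split; first exact: num_real.
    move=> t t1 x /SE x1 /=; apply: le_trans (ltW t1).
    rewrite [leLHS]/Num.norm /= mx_normrE; apply: bigmax_le => //= -[i j] _ /=.
    rewrite -x1 -[leRHS]ger0_norm ?fnorm_ge0 // -ler_sqr ?nnegrE //.
    rewrite !real_normK ?num_real // sqr_fnormE (bigD1 i) //= (bigD1 j) //= -addrA lerDl.
    rewrite addr_ge0 // sumr_ge0 // => k _; first exact: sqr_ge0.
    by rewrite sumr_ge0 // => ? _; rewrite sqr_ge0.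
  exact: ((continuous_closedP _).1 (continuous_sqr_mul (A := 1%:M)) _ (@closed_eq R 1)).
have [v vS vmax] := @EVT_max_rV R _ _ S S0 cS
  (continuous_subspaceT (continuous_sqr_mul (A := A))).
move: vS; rewrite inE SE => v1.
exists v^T; first by rewrite fnorm_tr.
move=> x; have [/fnorm_eq0 ->|x0] := eqVneq (fnorm x) 0.
  by rewrite mulmx0 !fnorm0 mulr0.
have xp : 0 < fnorm x by rewrite lt_def x0 fnorm_ge0.
have := vmax ((fnorm x)^-1 *: x^T); rewrite inE SE -!sqr_fnorm_mul_tr.
rewrite fnormZ fnorm_tr ger0_norm ?invr_ge0 ?fnorm_ge0 // mulVf // => /(_ erefl).
rewrite ler_pXn2r ?nnegrE ?fnorm_ge0 // linearZ /= trmxK -scalemxAr fnormZ.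
by rewrite ger0_norm ?invr_ge0 ?fnorm_ge0 // mulrC ler_pdivrMr.
Qed.

(** The Householder reflection exchanging the unit vectors [u] and [e]. *)
Lemma exists_reflection n (u e : 'cV[R]_n) : fnorm u = 1 -> fnorm e = 1 ->
  exists2 P : 'M[R]_n, P^T *m P = 1%:M & P *m e = u.
Proof.
move=> u1 e1; have [->|ue] := eqVneq u e.
  by exists 1%:M; rewrite ?trmx1 ?mul1mx.
pose w := u - e; pose c := mxdot w w.
have c0 : c != 0.
  rewrite /c -sqr_fnorm sqrf_eq0; apply: contra ue => /eqP /fnorm_eq0 /eqP.
  by rewrite subr_eq0.
have dotM (x y : 'cV[R]_n) : x^T *m y = (mxdot x y)%:M.
  by rewrite [LHS]mx11_scalar /mxdot /mxtrace big_ord1.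
have cE : c = - 2 * mxdot w e.
  rewrite /c /w !mxdotDl !mxdotDr -scaleN1r !mxdotZl !mxdotZr -!sqr_fnorm u1 e1.
  by rewrite (mxdotC e u); ring.
pose P : 'M[R]_n := 1%:M - (2 / c) *: (w *m w^T).
have PT : P^T = P.
  by rewrite [LHS]linearB /= trmx1 [in LHS]linearZ /= trmx_mul trmxK.
exists P; last first.
  rewrite mulmxBl mul1mx -scalemxAl -mulmxA dotM mul_mx_scalar scalerA.
  have -> : mxdot w e = - (c / 2) by rewrite {1}cE; field.
  have -> : 2 / c * - (c / 2) = - 1 by field.
  by rewrite scaleN1r opprK /w addrC subrK.
rewrite PT /P mulmxBl mul1mx mulmxBr mulmx1.
rewrite -scalemxAl -scalemxAr scalerA mulmxA -(mulmxA w) dotM mul_mx_scalar -/c.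
rewrite -scalemxAl scalerA.
have -> : 2 / c * (2 / c) * c = 2 / c + 2 / c by field.
by rewrite scalerDl opprB addrK subrK.
Qed.

End SVD.

Section SVDExistence.
Variable R : realType.

Lemma sqr_fnorm_col_mx m1 m2 n (A : 'M[R]_(m1, n)) (B : 'M[R]_(m2, n)) :
  fnorm (col_mx A B) ^+ 2 = fnorm A ^+ 2 + fnorm B ^+ 2.
Proof. by rewrite !sqr_fnorm /mxdot tr_col_mx mul_row_col mxtraceD. Qed.

Lemma sqr_fnorm_row_mx m n1 n2 (A : 'M[R]_(m, n1)) (B : 'M[R]_(m, n2)) :
  fnorm (row_mx A B) ^+ 2 = fnorm A ^+ 2 + fnorm B ^+ 2.
Proof. by rewrite -fnorm_tr tr_row_mx sqr_fnorm_col_mx !fnorm_tr. Qed.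

Lemma fnorm_delta n (j : 'I_n) : fnorm (delta_mx j 0 : 'cV[R]_n) = 1.
Proof.
apply/eqP; rewrite -(@eqrXn2 _ 2) ?fnorm_ge0 // expr1n sqr_fnorm.
by rewrite /mxdot trmx_delta mul_delta_mx /mxtrace big_ord1 mxE eqxx.
Qed.

Lemma svd_diag_block m n (a : R) s :
  block_mx (a%:M : 'M[R]_1) 0 0 (svd_diag m n s) =
  svd_diag (1 + m) (1 + n) (fun j => if (j <= 1)%N then a else s j.-1).
Proof.
apply/matrixP => i j; case: (split_ordP i) => i' ->; case: (split_ordP j) => j' ->.
- by rewrite block_mxEul !mxE !ord1.
- by rewrite block_mxEur !mxE /= ord1 /= mulr0n.
- by rewrite block_mxEdl !mxE /= ord1 /= mulr0n.
- by rewrite block_mxEdr !mxE /= !add1n eqSS.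
Qed.

(** Take a unit vector [v] that maximises |A v|, and rotate [v] and [A v] to
    multiples of the first basis vectors.  The first column of the rotated matrix
    is then |A v| times a basis vector; so is its first row, since otherwise that
    row would be longer than |A v|, which bounds the norm of the transpose as
    well.  The remaining block is decomposed by induction, and |A v| bounds
    its singular values. *)
Lemma exists_svd m n (A : 'M[R]_(m, n)) :
  exists U s V, is_svd A U s V.
Proof.
have svd0 p q (B : 'M[R]_(p, q)) : B = 0 -> is_svd B 1%:M (fun=> 0) 1%:M.
  move=> ->; split; split=> //; rewrite ?trmx1 ?mul1mx ?mulmx1 //.
  by apply/matrixP => i j; rewrite !mxE mul0rn.
elim: n m A => [m A|n IHn [|m] A].
- exists 1%:M, (fun=> 0), 1%:M; apply: svd0.
  by apply/matrixP => i [].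
- exists 1%:M, (fun=> 0), 1%:M; apply: svd0.
  by apply/matrixP => -[].
move: A; rewrite -[m.+1]/(1 + m)%N -[n.+1]/(1 + n)%N => A.
have [v v1 Av] : exists2 v : 'cV[R]_(1 + n), fnorm v = 1 & opnorm_le A (fnorm (A *m v)).
  exact: exists_max_vector.
set a := fnorm (A *m v) in Av.
have [a0|a0] := eqVneq a 0.
  exists 1%:M, (fun=> 0), 1%:M; apply: svd0.
  apply/matrixP => i j; have := Av (delta_mx j 0).
  rewrite a0 mul0r => h; have /fnorm_eq0 : fnorm (A *m delta_mx j (0 : 'I_1)) = 0.
    by apply/eqP; rewrite eq_le h fnorm_ge0.
  by rewrite -colE => /matrixP/(_ i 0); rewrite !mxE.
have ap : 0 < a by rewrite lt_def a0 fnorm_ge0.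
have u1 : fnorm (a^-1 *: (A *m v)) = 1.
  by rewrite fnormZ ger0_norm ?invr_ge0 ?fnorm_ge0 // mulVf.
pose e k : 'cV[R]_(1 + k) := delta_mx 0 0.
have e1 k : fnorm (e k) = 1 by exact: fnorm_delta.
have [P PP Pu] := exists_reflection u1 (e1 m).
have [Q QQ Qv] := exists_reflection v1 (e1 n).
pose C : 'M[R]_(1 + m, 1 + n) := P^T *m A *m Q.
have PP' := mulmx1C PP; have QQ' := mulmx1C QQ.
have AC : A = P *m C *m Q^T.
  by rewrite /C !mulmxA PP' mul1mx -mulmxA QQ' mulmx1.
have Ca : opnorm_le C a.
  move=> x; rewrite /C -!mulmxA fnorm_isom ?trmxK //.
  by apply: le_trans (Av _) _; rewrite fnorm_isom.
have Ce : C *m e n = a *: e m.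
  rewrite /C -mulmxA Qv.
  rewrite -mulmxA -(mul1mx (e m)) -PP -mulmxA Pu.
  by rewrite scalemxAr scalerA mulfV // scale1r.
pose w := ursubmx C; pose B := drsubmx C.
have e0E k : e k = col_mx (1%:M : 'M[R]_1) (0 : 'M[R]_(k, 1)).
  apply/matrixP => i j; rewrite /e ord1; case: (split_ordP i) => i' ->.
    by rewrite col_mxEu !mxE ord1 /=.
  by rewrite col_mxEd !mxE.
have CE : C = block_mx a%:M w 0 B.
  move: Ce; rewrite !e0E -[C in C *m _]submxK mul_block_col !mulmx1 !mulmx0 !addr0.
  rewrite scale_col_mx scaler0 => /eq_col_mx[CEul CEdl].
  by rewrite -[LHS]submxK CEul CEdl scalemx1.
(* The first row of [C] has norm at most [a], and its first entry is [a]. *)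
have w0 : w = 0.
  have := opnorm_le_tr (ltW ap) Ca (e m).
  rewrite e1 mulr1 CE tr_block_mx e0E mul_block_col !mulmx1 !mulmx0 !addr0.
  rewrite fnorm_le_sqr ?(ltW ap) // sqr_fnorm_col_mx !fnorm_tr.
  rewrite [fnorm a%:M ^+ 2]sqr_fnormE !big_ord1 mxE eqxx mulr1n gerDl => h.
  apply: fnorm_eq0; apply/eqP; rewrite -sqrf_eq0.
  by rewrite eq_le h sqr_ge0.
have Ba : opnorm_le B a.
  move=> x; have := Ca (col_mx 0 x).
  rewrite CE w0 mul_block_col !mulmx0 !mul0mx !add0r.
  rewrite fnorm_le_sqr ?mulr_ge0 ?fnorm_ge0 ?(ltW ap) // exprMn !sqr_fnorm_col_mx.
  rewrite fnorm0 expr0n !add0r -exprMn -fnorm_le_sqr //.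
  by rewrite mulr_ge0 ?fnorm_ge0 ?(ltW ap).
have [U [s [V [[UU VV BE] [s0 sd sz]]]]] := IHn _ B.
have s1a j : (0 < j)%N -> s j <= a.
  move=> j0; apply: (@le_trans _ _ (s 1%N)); first by apply: sd; rewrite ltn0Sn.
  have [mn|mn] := leqP (minn m n) 0; first by rewrite sz ?(ltW ap).
  move: mn; rewrite leq_min => /andP[m0 n0].
  have VVd (y : 'cV_n) : V^T *m (V *m y) = y by rewrite mulmxA VV mul1mx.
  have := Ba (V *m delta_mx (Ordinal n0) 0).
  rewrite BE -!mulmxA VVd (fnorm_isom _ UU) (fnorm_isom _ VV) fnorm_delta mulr1.
  have -> : svd_diag m n s *m delta_mx (Ordinal n0) (0 : 'I_1) =
            s 1%N *: delta_mx (Ordinal m0) 0.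
    rewrite -colE; apply/matrixP => i k; rewrite ord1 !mxE eqxx andbT.
    rewrite -val_eqE /= eq_sym; case: eqP => [<-|_]; first by rewrite mulr1.
    by rewrite mulr0.
  by rewrite fnormZ fnorm_delta mulr1 ger0_norm.
pose Ub : 'M[R]_(1 + m) := block_mx 1%:M 0 0 U.
pose Vb : 'M[R]_(1 + n) := block_mx 1%:M 0 0 V.
exists (P *m Ub), (fun j => if (j <= 1)%N then a else s j.-1), (Q *m Vb).
have blk k (X Y : 'M[R]_k) : Y^T *m Y = 1%:M -> X^T *m X = 1%:M ->
    (Y *m X)^T *m (Y *m X) = 1%:M.
  by move=> YY XX; rewrite trmx_mul mulmxA -(mulmxA X^T) YY mulmx1.
have blk1 k (X : 'M[R]_k) : X^T *m X = 1%:M ->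
    (block_mx 1%:M 0 0 X : 'M[R]_(1 + k))^T *m block_mx 1%:M 0 0 X = 1%:M.
  move=> XX; rewrite tr_block_mx mulmx_block !trmx0 !mulmx0 !mul0mx trmx1 mulmx1.
  by rewrite XX !addr0 add0r -scalar_mx_block.
split; split.
- by apply: blk => //; exact: blk1.
- by apply: blk => //; exact: blk1.
- rewrite AC -(svd_diag_block m n a s) trmx_mul.
  have -> : Vb^T = block_mx 1%:M 0 0 V^T by rewrite tr_block_mx trmx1 !trmx0.
  rewrite /Ub CE w0 BE.
  rewrite !mulmxA; congr (_ *m _); rewrite -!mulmxA; congr (_ *m _).
  rewrite !mulmx_block !mulmx0 !mul0mx mulmx1 mul1mx.
  by rewrite !addr0 !add0r !mulmx0.
- by move=> j; case: ifP => _; [exact: ltW | exact: s0].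
- move=> i j /andP[i0 ij]; case: (leqP j 1) => j1.
    by rewrite (leq_trans ij j1).
  case: (leqP i 1) => i1; first by apply: s1a; case: (j) j1.
  by apply: sd; lia.
- by move=> j h; case: ifP => j1; [lia | apply: sz; lia].
Qed.

Lemma svdP m n (A : 'M[R]_(m, n)) : is_svd A (svd A).1.1 (svd A).1.2 (svd A).2.
Proof.
have [U [s [V h]]] := exists_svd A.
by apply: (@xgetPex _ _ [set T | is_svd A T.1.1 T.1.2 T.2]%classic); exists (U, s, V).
Qed.

Lemma is_svd_tr m n (A : 'M[R]_(m, n)) U s V :
  is_svd A U s V -> is_svd A^T V s U.
Proof.
move=> [[UU VV ->] [s0 sd sz]]; split; split=> //; last first.
  by move=> j; rewrite minnC; exact: sz.
rewrite !trmx_mul trmxK mulmxA; congr (_ *m _ *m _).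
apply/matrixP => i j; rewrite !mxE eq_sym.
by case: eqP => [->|_].
Qed.

Lemma tr_top_cols k r (U : 'M[R]_k) :
  (r <= k)%N -> U^T *m U = 1%:M -> (top_cols r U)^T *m top_cols r U = 1%:M.
Proof.
move=> rk UU; rewrite /top_cols trmx_mul mulmxA -(mulmxA (pid_mx r)^T) UU mulmx1.
by rewrite tr_pid_mx pid_mx_id // pid_mx_1.
Qed.

Lemma mxrank_tr_unit k r (Q : 'M[R]_(k, r)) (T : 'M[R]_r) :
  \rank (Q *m T) = r -> T \in unitmx.
Proof.
by move=> rk; rewrite -row_full_unit -col_leq_rank -{1}rk mxrankM_maxr.
Qed.

(** For a matrix of full column rank, the left singular vectors that define its
    leverage scores form an orthonormal basis of its range. *)
Lemma svd_full_col m r (A : 'M[R]_(m, r)) U s V : is_svd A U s V ->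
  \rank A = r ->
  (top_cols r U)^T *m top_cols r U = 1%:M /\
  exists2 T, T \in unitmx & A = top_cols r U *m T.
Proof.
move=> [[UU VV AE] _] rA.
have rm : (r <= m)%N by rewrite -rA rank_leq_row.
split; first exact: tr_top_cols.
exists (diag_mx (\row_j s j.+1) *m V^T).
  apply: (@mxrank_tr_unit _ _ (top_cols r U)); rewrite -[RHS]rA AE /top_cols.
  congr (\rank _); rewrite !mulmxA; congr (_ *m _); rewrite -mulmxA; congr (_ *m _).
  apply/matrixP => i j; rewrite mul_mx_diag !mxE.
  by case: eqP => [->|_]; rewrite ?ltn_ord ?mul1r ?mul0r.
rewrite [LHS]AE /top_cols.
rewrite !mulmxA; congr (_ *m _); rewrite -mulmxA; congr (_ *m _).
apply/matrixP => i j; rewrite mul_mx_diag !mxE.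
by case: eqP => [->|_]; rewrite ?ltn_ord ?mul1r ?mul0r.
Qed.

End SVDExistence.

(** * The residual of a truncated singular value decomposition *)

Section SingularSubspaces.
Variable R : realType.

Lemma opnorm_le_isom m n (Q : 'M[R]_(m, n)) : Q^T *m Q = 1%:M -> opnorm_le Q 1.
Proof. by move=> QQ x; rewrite fnorm_isom // mul1r. Qed.

Lemma opnorm_le_isom_tr m n (Q : 'M[R]_(m, n)) : Q^T *m Q = 1%:M -> opnorm_le Q^T 1.
Proof. by move=> QQ; apply: opnorm_le_tr => //; exact: opnorm_le_isom. Qed.

Lemma opnorm_le_mul m n p (A : 'M[R]_(m, n)) (B : 'M[R]_(n, p)) a b :
  0 <= a -> opnorm_le A a -> opnorm_le B b -> opnorm_le (A *m B) (a * b).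
Proof.
move=> a0 Aa Bb x; rewrite -mulmxA -mulrA; apply: le_trans (Aa _) _.
by rewrite ler_wpM2l.
Qed.

Lemma sqr_fnorm_diag n (t : 'I_n -> R) (x : 'cV[R]_n) :
  fnorm (diag_mx (\row_j t j) *m x) ^+ 2 = \sum_j (t j * x j 0) ^+ 2.
Proof.
by rewrite sqr_fnormE; apply: eq_bigr => j _; rewrite big_ord1 mul_diag_mx !mxE.
Qed.

Lemma opnorm_le_svd_diag m n (t : nat -> R) c :
  0 <= c -> (forall j, (0 < j)%N -> `|t j| <= c) -> opnorm_le (svd_diag m n t) c.
Proof.
move=> c0 tc.
have -> : svd_diag m n t = pid_mx n *m diag_mx (\row_(j < n) t j.+1).
  apply/matrixP => i j; rewrite mul_mx_diag !mxE.
  by case: eqP => [->|_]; rewrite ?ltn_ord ?mul1r ?mul0r.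
rewrite -[c]mul1r; apply: opnorm_le_mul => //; last first.
  move=> x; rewrite fnorm_le_sqr ?mulr_ge0 ?fnorm_ge0 // exprMn sqr_fnorm_diag.
  rewrite sqr_fnormE mulr_sumr; apply: ler_sum => j _; rewrite big_ord1 exprMn.
  rewrite ler_wpM2r ?sqr_ge0 // -[t _ ^+ 2]real_normK ?num_real //.
  by rewrite ler_pXn2r ?nnegrE // tc.
case: (leqP n m) => nm.
  by apply: opnorm_le_isom; rewrite tr_pid_mx pid_mx_id // pid_mx_1.
rewrite -[pid_mx n]trmxK; apply: opnorm_le_isom_tr; rewrite trmxK tr_pid_mx.
rewrite -pid_mx_minv; have /minn_idPl -> : (m <= n)%N := ltnW nm.
have -> : pid_mx n = pid_mx m :> 'M[R]_(n, m).
  apply/matrixP => i j; rewrite !mxE; case: eqP => //= ij.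
  by rewrite ij !ltn_ord (ltn_trans (ltn_ord j)).
by rewrite pid_mx_id ?pid_mx_1 // ltnW.
Qed.

Section Split.
Variables (m n r : nat) (M : 'M[R]_(m, n)) (U : 'M[R]_m) (s : nat -> R) (V : 'M[R]_n).
Hypothesis Msvd : is_svd M U s V.
Let N := M - truncation r U s V.

Lemma residualE :
  N = U *m svd_diag m n (fun j => if (j <= r)%N then 0 else s j) *m V^T.
Proof.
have [[_ _ ME] _] := Msvd.
rewrite /N /truncation {1}ME -mulmxBl -mulmxBr; congr (_ *m _ *m _).
apply/matrixP => i j; rewrite !mxE.
by case: eqP => _; case: ifP => _; rewrite ?mulr1n ?mulr0n ?subr0 ?subrr.
Qed.

Lemma truncationE : truncation r U s V =
  top_cols r U *m diag_mx (\row_(j < r) s j.+1) *m (top_cols r V)^T.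
Proof.
rewrite /truncation /top_cols trmx_mul !mulmxA; congr (_ *m _).
rewrite -!mulmxA; congr (_ *m _); rewrite tr_pid_mx.
have -> : diag_mx (\row_(j < r) s j.+1) *m pid_mx r =
    pid_mx r *m diag_mx (\row_(j < n) s j.+1).
  apply/matrixP => i j; rewrite mul_mx_diag mul_diag_mx !mxE mulrC.
  by case: eqP => [->|_] //; rewrite !mul0r.
rewrite mulmxA pid_mx_id //; apply/matrixP => i j; rewrite mul_mx_diag !mxE.
case: eqP => [->|_]; last by rewrite mul0r.
by case: leqP; rewrite ?mul1r ?mul0r.
Qed.

Lemma tr_top_cols_residual : (top_cols r U)^T *m N = 0.
Proof.
have [[UU _ _] _] := Msvd.
rewrite residualE /top_cols trmx_mul !mulmxA -(mulmxA (pid_mx r)^T) UU mulmx1.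
apply/eqP; rewrite (_ : _ *m svd_diag _ _ _ = 0) ?mul0mx //; apply/matrixP => i j.
rewrite !mxE big1 // => k _; rewrite !mxE.
by case: eqP => [->|_]; rewrite ?mul0r //= ltn_ord mul0rn mulr0.
Qed.

Lemma opnorm_le_residual : opnorm_le N (s r.+1).
Proof.
have [[UU VV _] [s0 sd _]] := Msvd.
rewrite residualE -[s _]mulr1 -[s _]mul1r.
apply: opnorm_le_mul; last 1 first.
- exact: opnorm_le_isom_tr.
- by rewrite mul1r.
apply: opnorm_le_mul => //; first exact: opnorm_le_isom.
apply: opnorm_le_svd_diag => // j j0; case: leqP => jr; first by rewrite normr0.
by rewrite ger0_norm // sd.
Qed.

Lemma sing_val_le_residual : (r < minn m n)%N -> s r.+1 <= fnorm N.
Proof.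
move=> rr; have [[UU VV _] [s0 sd _]] := Msvd.
move: rr; rewrite leq_min => /andP[rm rn].
have := opnorm_le_fnorm N (V *m delta_mx (Ordinal rn) 0).
rewrite residualE -!mulmxA (mulmxA V^T) VV mul1mx (fnorm_isom _ UU) (fnorm_isom _ VV).
rewrite fnorm_delta mulr1.
have -> : svd_diag m n (fun j => if (j <= r)%N then 0 else s j) *m
    delta_mx (Ordinal rn) (0 : 'I_1) = s r.+1 *: delta_mx (Ordinal rm) 0.
  rewrite -colE; apply/matrixP => i k; rewrite ord1 !mxE eqxx andbT.
  rewrite -val_eqE /=; case: eqP => [->|_]; last by rewrite mulr0.
  by rewrite ltnn mulr1.
by rewrite fnormZ fnorm_delta mulr1 ger0_norm.
Qed.

Lemma sing_val_lower (x : 'cV[R]_r) :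
  s r * fnorm x <= fnorm (diag_mx (\row_(j < r) s j.+1) *m x).
Proof.
have [_ [s0 sd _]] := Msvd.
rewrite -ler_sqr ?nnegrE ?mulr_ge0 ?fnorm_ge0 // exprMn sqr_fnorm_diag sqr_fnormE.
rewrite mulr_sumr; apply: ler_sum => j _; rewrite big_ord1 exprMn.
by rewrite ler_wpM2r ?sqr_ge0 // ler_sqr ?nnegrE // sd //=.
Qed.

End Split.

Lemma tr_truncation m n r (U : 'M[R]_m) s (V : 'M[R]_n) :
  (truncation r U s V)^T = truncation r V s U.
Proof.
rewrite /truncation !trmx_mul trmxK mulmxA; congr (_ *m _ *m _).
apply/matrixP => i j; rewrite !mxE eq_sym.
by case: eqP => [->|_].
Qed.

End SingularSubspaces.

(** * Principal angle distance *)

Section Distance.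
Variable R : realType.

Lemma exists_orth_basis k d p (E : 'M[R]_(k, d)) : \rank E = p ->
  exists G : 'M[R]_(k, p), G^T *m G = 1%:M /\ (G^T == E^T)%MS.
Proof.
rewrite -mxrank_tr => <-; pose F := (row_base E^T)^T.
have rF : \rank F = \rank E^T by rewrite mxrank_tr eq_row_base.
have [GG [T Tu FE]] := svd_full_col (svdP F) rF.
exists (top_cols (\rank E^T) (svd F).1.1); split=> //.
apply/eqmxP; apply: eqmx_trans (eq_row_base E^T).
have -> : row_base E^T = T^T *m (top_cols (\rank E^T) (svd F).1.1)^T.
  by rewrite -trmx_mul -FE trmxK.
by apply/eqmx_sym/eqmxMfull; rewrite row_full_unit unitmx_tr.
Qed.

Lemma orth_basisP k d (E : 'M[R]_(k, d)) :
  (orth_basis E)^T *m orth_basis E = 1%:M /\ ((orth_basis E)^T == E^T)%MS.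
Proof.
exact: (@xgetPex _ _ [set G : 'M[R]_(k, \rank E) |
  G^T *m G = 1%:M /\ (G^T == E^T)%MS]%classic) (exists_orth_basis erefl).
Qed.

Lemma trmx_submxP k d1 d2 (A : 'M[R]_(k, d1)) (B : 'M[R]_(k, d2)) :
  (A^T <= B^T)%MS -> exists T, A = B *m T.
Proof.
by move=> /submxP[T AT]; exists T^T; rewrite -[LHS]trmxK AT trmx_mul trmxK.
Qed.

(** If [G] is an orthonormal basis of the orthogonal complement of the range of
    [E1], then the distance from [y] to that range is |G^T y|, and it is attained
    at [y - G G^T y]. *)
Lemma Dist_le k d1 d2 (E1 : 'M[R]_(k, d1)) (E2 : 'M[R]_(k, d2)) c :
  0 <= c -> \rank E1 = \rank E2 ->
  Dist E1 E2 <= c <->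
  forall z : 'cV[R]_d2, exists x : 'cV[R]_d1,
    fnorm (E2 *m z - E1 *m x) <= c * fnorm (E2 *m z).
Proof.
move=> c0 rE; rewrite /Dist rE eqxx.
have [HH /andP[HE EH]] := orth_basisP E2.
have [GG /andP[GE EG]] := orth_basisP (orth_compl E1).
set G := orth_basis _ in GG GE EG *; set H := orth_basis _ in HH HE EH *.
have GE1 : G^T *m E1 = 0 by apply/sub_kermxP; rewrite /orth_compl trmxK in GE.
(* The range of [E1] is the whole kernel of [G^T], by dimension. *)
have kG (y : 'cV[R]_k) : exists x, y - G *m (G^T *m y) = E1 *m x.
  apply: trmx_submxP; apply: (@submx_trans _ _ _ _ _ _ (kermx G)).
    apply/sub_kermxP; rewrite linearB /= !trmx_mul trmxK mulmxBl.
    by rewrite -!mulmxA GG mulmx1 subrr.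
  have : (E1^T <= kermx G)%MS.
    by apply/sub_kermxP; rewrite -[G]trmxK -trmx_mul GE1 trmx0.
  move=> /mxrank_leqif_sup /geq_leqif <-.
  have rG : \rank G = (k - \rank E1)%N.
    rewrite -[G]trmxK mxrank_tr.
    have /eqmx_rank -> : (G^T == (orth_compl E1)^T)%MS by rewrite GE EG.
    by rewrite mxrank_tr /orth_compl mxrank_tr mxrank_ker.
  by rewrite [leqRHS]mxrank_tr mxrank_ker [X in (k - X)%N]rG subKn // rank_leq_row.
rewrite (spectral_norm_le _ c0); split=> [h z|h w].
  have [x Ex] := kG (E2 *m z); exists x; rewrite -Ex opprB addrC subrK.
  have [T E2H] := trmx_submxP EH.
  rewrite (fnorm_isom _ GG) E2H -!mulmxA (fnorm_isom _ HH) mulmxA; exact: h.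
have [T HE2] := trmx_submxP HE.
have [x] := h (T *m w); rewrite mulmxA -HE2 => hx.
rewrite (fnorm_isom _ HH) in hx; apply: le_trans hx.
have -> : G^T *m H *m w = G^T *m (H *m w - E1 *m x).
  by rewrite mulmxBr !mulmxA GE1 mul0mx subr0.
by apply: le_trans (opnorm_le_isom_tr GG _) _; rewrite mul1r.
Qed.

(** When [E] has orthonormal columns and 0 <= d < 1, this is [Dist A E <= d], in a form
    that involves no choice of bases: a vector of the range of [E] is compared
    with some vector of the range of [A], not with its projection. *)
Definition range_near k r (A E : 'M[R]_(k, r)) (d : R) : Prop :=
  \rank A = r /\
  forall z : 'cV[R]_r, exists x : 'cV[R]_r, fnorm (E *m z - A *m x) <= d * fnorm z.

Lemma mxrank_isom k r (E : 'M[R]_(k, r)) : E^T *m E = 1%:M -> \rank E = r.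
Proof.
move=> EE; apply/eqP; rewrite eqn_leq rank_leq_col /=.
by rewrite -{1}(mxrank1 R r) -EE mxrankM_maxr.
Qed.

Lemma Dist_near k r (A E : 'M[R]_(k, r)) d :
  E^T *m E = 1%:M -> 0 <= d -> Dist A E <= d -> d < 1 -> range_near A E d.
Proof.
move=> EE d0 AE d1; have rE := mxrank_isom EE.
have rA : \rank A = \rank E.
  move: AE; rewrite /Dist; case: eqP => // _ /(lt_le_trans d1).
  by rewrite ltxx.
split; first by rewrite rA.
move=> z; have [x hx] := (Dist_le d0 rA).1 AE z.
by exists x; rewrite (fnorm_isom _ EE) in hx.
Qed.

Lemma near_Dist k r (A E : 'M[R]_(k, r)) d :
  E^T *m E = 1%:M -> 0 <= d -> range_near A E d -> Dist A E <= d.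
Proof.
move=> EE d0 [rA AE]; apply/Dist_le => //; first by rewrite rA mxrank_isom.
by move=> z; have [x hx] := AE z; exists x; rewrite (fnorm_isom _ EE).
Qed.

Lemma near_le k r (A E : 'M[R]_(k, r)) c d : c <= d -> range_near A E c -> range_near A E d.
Proof.
move=> cd [rA AE]; split=> // z; have [x hx] := AE z; exists x.
by apply: le_trans hx _; rewrite ler_wpM2r ?fnorm_ge0.
Qed.

Lemma near_mulr k r (A E : 'M[R]_(k, r)) T d :
  T \in unitmx -> range_near A E d -> range_near (A *m T) E d.
Proof.
move=> Tu [rA AE]; split; first by rewrite mxrankMfree // row_free_unit.
move=> z; have [x hx] := AE z; exists (invmx T *m x).
by rewrite mulmxA mulmxK.
Qed.

End Distance.

(** * Pseudoinverses and sketched least squares *)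

Section PseudoInverse.
Variable R : realType.

Lemma is_pseudoinverse_tr m n (W : 'M[R]_(m, n)) X :
  is_pseudoinverse W X -> is_pseudoinverse W^T X^T.
Proof. by move=> [a b c d]; split; rewrite -!trmx_mul ?mulmxA ?a ?b ?c ?d. Qed.

Lemma is_pseudoinverse_full m n (W : 'M[R]_(m, n)) :
  W^T *m W \in unitmx -> is_pseudoinverse W (invmx (W^T *m W) *m W^T).
Proof.
move=> Wu; split.
- by rewrite -!mulmxA mulVmx // mulmx1.
- by rewrite -[_ *m _ *m W]mulmxA mulVmx // mul1mx.
- by rewrite !trmx_mul trmxK trmx_inv trmx_mul trmxK mulmxA.
- by rewrite -mulmxA mulVmx // trmx1.
Qed.

Lemma pseudoinverse_full_col m n (W : 'M[R]_(m, n)) :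
  W^T *m W \in unitmx -> is_pseudoinverse W (pseudoinverse W).
Proof.
move=> Wu; apply: (@xgetPex _ _ [set X | is_pseudoinverse W X]%classic).
by eexists; exact: is_pseudoinverse_full.
Qed.

Lemma pseudoinverse_full_row m n (W : 'M[R]_(m, n)) :
  W *m W^T \in unitmx -> is_pseudoinverse W (pseudoinverse W).
Proof.
move=> Wu; apply: (@xgetPex _ _ [set X | is_pseudoinverse W X]%classic).
exists (invmx (W^T^T *m W^T) *m W^T^T)^T; rewrite /= -{1}[W]trmxK.
apply: is_pseudoinverse_tr; by apply: is_pseudoinverse_full; rewrite trmxK.
Qed.

(** The normal equations; when [W] has full column rank they determine [X]. *)
Lemma is_pseudoinverse_normal m n (W : 'M[R]_(m, n)) X :
  is_pseudoinverse W X -> W^T *m W *m X = W^T.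
Proof. by move=> [a _ c _]; rewrite -mulmxA -c -trmx_mul a. Qed.

(** With [A = Q T] the normal equations of the sketched least squares problem
    read T^T G T X = T^T Q^T S^T, where [G = Q^T S^T S Q]. *)
Lemma sketched_solution k h l r (S : 'M[R]_(l, k)) (Q : 'M[R]_(k, r)) T
    (M : 'M[R]_(k, h)) X :
  T \in unitmx -> Q^T *m S^T *m S *m Q \in unitmx ->
  is_pseudoinverse (S *m (Q *m T)) X ->
  exists2 L, L \in unitmx & X *m (S *m M) = L *m (Q^T *m S^T *m S *m M).
Proof.
move=> Tu Gu /is_pseudoinverse_normal; rewrite !trmx_mul => hX.
have {}hX : (Q^T *m S^T *m S *m Q) *m T *m X = Q^T *m S^T.
  have /(congr1 (mulmx (invmx T^T))) := hX.
  by rewrite !mulmxA mulVmx ?unitmx_tr // !mul1mx.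
have XE (G : 'M[R]_r) C : G \in unitmx -> G *m T *m X = C -> X = invmx T *m invmx G *m C.
  by move=> uG <-; rewrite !mulmxA mulmxKV // mulVmx // mul1mx.
exists (invmx T *m invmx (Q^T *m S^T *m S *m Q)).
  by rewrite unitmx_mul !unitmx_inv Tu Gu.
by rewrite [in LHS](XE _ _ Gu hX) !mulmxA.
Qed.

End PseudoInverse.

(** * Perturbation of the row space of a sketch *)

Section Perturbation.
Variable R : realType.

(** The orthogonal projection is at least as close as the vector that
    [range_near] provides. *)
Lemma near_proj k r (A Q E : 'M[R]_(k, r)) T d :
  Q^T *m Q = 1%:M -> A = Q *m T -> range_near A E d ->
  forall z : 'cV[R]_r, fnorm (E *m z - Q *m (Q^T *m (E *m z))) <= d * fnorm z.
Proof.
move=> QQ -> [_ AE] z; have [x hx] := AE z; apply: le_trans hx.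
set y := E *m z; pose x' := Q^T *m y - T *m x.
have -> : y - Q *m T *m x = (y - Q *m (Q^T *m y)) + Q *m x'.
  by rewrite /x' mulmxBr !mulmxA addrA subrK.
rewrite -ler_sqr ?nnegrE ?fnorm_ge0 // [leRHS]sqr_fnormD mxdotC mxdot_mull mulmxBr.
rewrite [Q^T *m (Q *m _)]mulmxA QQ mul1mx subrr /mxdot mulmx0 mxtrace0 mulr0 addr0.
by rewrite lerDl sqr_ge0.
Qed.

Lemma sqr_fnorm_proj k r n (Q : 'M[R]_(k, r)) (y : 'M[R]_(k, n)) :
  Q^T *m Q = 1%:M ->
  fnorm (y - Q *m (Q^T *m y)) ^+ 2 = fnorm y ^+ 2 - fnorm (Q^T *m y) ^+ 2.
Proof.
move=> QQ; rewrite sqr_fnormD fnormN (fnorm_isom _ QQ) -scaleN1r mxdotZr.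
rewrite (mxdotC y) mxdot_mull -sqr_fnorm; ring.
Qed.

(** With [K = Y U1 D] and [L = Y N] the matrix is [V1 K^T + L^T], and [L V1 = 0],
    so that the tangent of its largest angle with the range of [V1] is |K^-1 L|.
    Let alpha be the largest angle between the ranges of [Q] and [U1].  Up to
    the errors of [Y], the matrix [K] is bounded below by sr cos(alpha), and [L]
    is [Q^T N], which is at most t sin(alpha) because [U1^T N = 0].
    As sin(alpha) <= d <= 1/2, the cosine exceeds 0.86, so that |K^-1 L| is at
    most 1.01 t d / (0.85 sr), which is less than 0.87 d. *)
Lemma near_perturbed k h r (U1 Q : 'M[R]_(k, r)) (V1 : 'M[R]_(h, r)) (D : 'M[R]_r)
    (N : 'M[R]_(k, h)) (Y : 'M[R]_(r, k)) (t sr d : R) :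
  U1^T *m U1 = 1%:M -> V1^T *m V1 = 1%:M ->
  U1^T *m N = 0 -> N *m V1 = 0 -> opnorm_le N t ->
  D^T = D -> (forall x : 'cV[R]_r, sr * fnorm x <= fnorm (D *m x)) ->
  0 < sr -> 0 <= t -> t <= 2^-1 * sr ->
  Q^T *m Q = 1%:M -> 0 <= d <= 2^-1 ->
  (forall z : 'cV[R]_r, fnorm (U1 *m z - Q *m (Q^T *m (U1 *m z))) <= d * fnorm z) ->
  fnorm (Y *m U1 - Q^T *m U1) <= 100^-1 ->
  fnorm (Y *m N - Q^T *m N) <= 100^-1 * (t * d) ->
  range_near (Y *m (U1 *m D *m V1^T + N))^T V1 (87 / 100 * d).
Proof.
move=> UU VV UN NV Nt DT Dsr sr0 t0 tsr QQ /andP[d0 d2] Qd Y1 Y3.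
pose c := Num.sqrt (1 - d ^+ 2).
have cd : c ^+ 2 = 1 - d ^+ 2 by rewrite sqr_sqrtr //; nra.
have c0 : 0 <= c by exact: sqrtr_ge0.
have c86 : 86 / 100 <= c by rewrite -ler_sqr ?nnegrE // ?cd; nra.
have cp : 0 < c by lra.
(* [c] is the least value that the cosine of the largest angle can have. *)
have QU : forall x : 'cV[R]_r, c * fnorm x <= fnorm ((Q^T *m U1) *m x).
  move=> x; rewrite -ler_sqr ?nnegrE ?mulr_ge0 ?fnorm_ge0 // exprMn cd -mulmxA.
  have := sqr_fnorm_proj (U1 *m x) QQ; rewrite (fnorm_isom _ UU) => Uxy.
  have : fnorm (U1 *m x - Q *m (Q^T *m (U1 *m x))) ^+ 2 <= d ^+ 2 * fnorm x ^+ 2.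
    by rewrite -exprMn -fnorm_le_sqr ?mulr_ge0 ?fnorm_ge0.
  by rewrite mulrBl mul1r Uxy; lra.
have {}QU := lower_bound_tr cp QU; rewrite trmx_mul trmxK in QU.
(* The angle between the ranges is symmetric, so the same [d] bounds the part
   of [Q] outside the range of [U1]. *)
have UQ (w : 'cV[R]_r) : fnorm (Q *m w - U1 *m (U1^T *m (Q *m w))) <= d * fnorm w.
  rewrite -ler_sqr ?nnegrE ?mulr_ge0 ?fnorm_ge0 // exprMn.
  rewrite (sqr_fnorm_proj _ UU) (fnorm_isom _ QQ).
  have : c ^+ 2 * fnorm w ^+ 2 <= fnorm (U1^T *m Q *m w) ^+ 2.
    by rewrite -exprMn ler_sqr ?nnegrE ?mulr_ge0 ?fnorm_ge0.
  by rewrite cd -mulmxA; lra.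
pose K := Y *m U1 *m D.
have KT (w : 'cV[R]_r) : 85 / 100 * sr * fnorm w <= fnorm (K^T *m w).
  rewrite /K trmx_mul DT -mulmxA; apply: le_trans (Dsr _).
  rewrite (mulrC (85 / 100)) -mulrA; apply: ler_wpM2l; first exact: ltW.
  have -> : (Y *m U1)^T *m w = U1^T *m Q *m w + (Y *m U1 - Q^T *m U1)^T *m w.
    by rewrite -mulmxDl [(_ - _)^T]linearB /= [(Q^T *m U1)^T]trmx_mul trmxK addrC subrK.
  apply: le_trans (ler_fnormB _ _).
  have h1 := QU w.
  have h2 : fnorm ((Y *m U1 - Q^T *m U1)^T *m w) <= 100^-1 * fnorm w.
    by apply: (opnorm_le_weaken _ (opnorm_le_fnorm _)); rewrite fnorm_tr.
  have := fnorm_ge0 w; nra.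
have LT (w : 'cV[R]_r) : fnorm ((Y *m N)^T *m w) <= 101 / 100 * (t * d) * fnorm w.
  have NU : N^T *m U1 = 0 by rewrite -[LHS]trmxK trmx_mul trmxK UN trmx0.
  have -> : (Y *m N)^T *m w = (Y *m N - Q^T *m N)^T *m w +
      N^T *m (Q *m w - U1 *m (U1^T *m (Q *m w))).
    rewrite mulmxBr !mulmxA NU !mul0mx subr0.
    by rewrite -mulmxDl [(_ - _)^T]linearB /= [(Q^T *m N)^T]trmx_mul trmxK subrK.
  apply: le_trans (ler_fnormD _ _) _.
  have h1 : fnorm ((Y *m N - Q^T *m N)^T *m w) <= 100^-1 * (t * d) * fnorm w.
    by apply: (opnorm_le_weaken _ (opnorm_le_fnorm _)); rewrite fnorm_tr.
  have h2 : fnorm (N^T *m (Q *m w - U1 *m (U1^T *m (Q *m w)))) <= t * (d * fnorm w).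
    by apply: le_trans (opnorm_le_tr t0 Nt _) _; rewrite ler_wpM2l.
  nra.
have ksr : 0 < 85 / 100 * sr by lra.
have KTu := lower_bound_unit ksr KT.
set M := U1 *m D *m V1^T + N.
have YM : Y *m M = K *m V1^T + Y *m N by rewrite /M mulmxDr !mulmxA.
have YMV : Y *m M *m V1 = K.
  by rewrite YM mulmxDl -(mulmxA K) VV mulmx1 -(mulmxA Y N) NV mulmx0 addr0.
split.
  rewrite mxrank_tr; apply/eqP; rewrite eqn_leq rank_leq_row /=.
  have rK : \rank K = r by rewrite -mxrank_tr mxrank_unit.
  by rewrite -[leqLHS]rK -YMV mxrankM_maxl.
move=> z; exists (invmx K^T *m z); set w := invmx K^T *m z.
have zw : z = K^T *m w by rewrite mulmxA mulmxV // mul1mx.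
have -> : V1 *m z - (Y *m M)^T *m w = - ((Y *m N)^T *m w).
  rewrite YM [(_ + _)^T]linearD /= [(K *m V1^T)^T]trmx_mul trmxK mulmxDl -mulmxA -zw.
  by rewrite opprD addrA subrr add0r.
rewrite fnormN; apply: le_trans (LT w) _.
have Kw := KT w; rewrite -zw in Kw.
apply: (@le_trans _ _ (87 / 100 * d * (85 / 100 * sr * fnorm w))); last first.
  by rewrite ler_wpM2l // mulr_ge0.
have w0 := fnorm_ge0 w.
have h1 : t * d * fnorm w <= 2^-1 * sr * d * fnorm w by rewrite !ler_wpM2r.
have h2 : 0 <= sr * d * fnorm w by rewrite !mulr_ge0 // ltW.
lra.
Qed.

End Perturbation.

(** * Mean square error of sampled products *)

Section Sampling.
Variable R : realType.

Lemma sum_draws_prod l k (F : 'I_l -> 'I_k -> R) :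
  \sum_(N : draws l k) \prod_t F t (N t) = \prod_t \sum_i F t i.
Proof. by rewrite bigA_distr_bigA. Qed.

Lemma sum_draws_prob l k (p : 'I_k -> R) :
  \sum_i p i = 1 -> \sum_(N : draws l k) draws_prob p N = 1.
Proof.
move=> p1; rewrite (sum_draws_prod (fun _ i => p i)).
by rewrite big1.
Qed.

Lemma draws_prob_ge0 l k (p : 'I_k -> R) (N : draws l k) :
  is_pos_distr p -> 0 <= draws_prob p N.
Proof. by move=> [p0 _]; apply: prodr_ge0 => t _; exact: ltW. Qed.

(** Distinct draws are independent, so that only the diagonal terms of the square
    survive. *)
Lemma draws_variance l k (p g : 'I_k -> R) :
  \sum_i p i = 1 -> \sum_i p i * g i = 0 ->
  \sum_(N : draws l k) draws_prob p N * (\sum_t g (N t)) ^+ 2 =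
  l%:R * \sum_i p i * g i ^+ 2.
Proof.
move=> p1 pg.
pose F (t t' : 'I_l) s i :=
  p i * ((if s == t then g i else 1) * (if s == t' then g i else 1)).
have -> : \sum_(N : draws l k) draws_prob p N * (\sum_t g (N t)) ^+ 2 =
    \sum_t \sum_t' \sum_(N : draws l k) \prod_s F t t' s (N s).
  under [in RHS]eq_bigr => t _ do rewrite exchange_big.
  rewrite exchange_big /=; apply: eq_bigr => N _.
  rewrite expr2 mulr_suml mulr_sumr; apply: eq_bigr => t _.
  rewrite !mulr_sumr; apply: eq_bigr => t' _.
  by rewrite /F !big_split /= -!big_mkcond /= !big_pred1_eq.
have -> : l%:R * \sum_i p i * g i ^+ 2 = \sum_(t < l) \sum_i p i * g i ^+ 2.
  by rewrite sumr_const card_ord mulr_natl.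
have FE t t' s : (s != t) -> (s != t') -> \sum_i F t t' s i = 1.
  move=> /negPf st /negPf st'; rewrite -[RHS]p1; apply: eq_bigr => i _.
  by rewrite /F st st' !mulr1.
apply: eq_bigr => t _; rewrite (bigD1 t) //= sum_draws_prod.
rewrite [X in _ + X]big1 => [|t' t't]; last first.
  rewrite sum_draws_prod (bigD1 t) //= -[RHS](mul0r (\prod_(s | s != t) \sum_i F t t' s i)).
  congr (_ * _); rewrite -[RHS]pg; apply: eq_bigr => i _.
  by rewrite /F eqxx eq_sym (negPf t't) mulr1.
rewrite addr0 (bigD1 t) //= [X in _ * X]big1 => [|s st]; last exact: FE.
by rewrite mulr1; apply: eq_bigr => i _; rewrite /F eqxx -expr2.
Qed.

Lemma sampling_mx_mulE l k c (p : 'I_k -> R) (N : draws l k) (W : 'M[R]_(k, c)) t b :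
  (sampling_mx p N *m W) t b = (Num.sqrt (l%:R * p (N t)))^-1 * W (N t) b.
Proof.
rewrite mxE (bigD1 (N t)) //= big1 ?addr0 => [|i iN].
  by rewrite /sampling_mx mxE mul_mx_diag !mxE eqxx mul1r.
by rewrite /sampling_mx mxE mul_mx_diag !mxE eq_sym (negPf iN) !mul0r.
Qed.

Lemma sketched_productE l k r c (p : 'I_k -> R) (N : draws l k)
    (Q : 'M[R]_(k, r)) (W : 'M[R]_(k, c)) a b :
  (0 < l)%N -> (forall i, 0 < p i) ->
  (Q^T *m (sampling_mx p N)^T *m sampling_mx p N *m W - Q^T *m W) a b =
  \sum_t (Q (N t) a * W (N t) b / (l%:R * p (N t)) - (Q^T *m W) a b / l%:R).
Proof.
move=> l0 p0; have l0' : 0 < l%:R :> R by rewrite ltr0n.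
rewrite -trmx_mul -mulmxA [LHS]mxE [X in _ + X]mxE sumrB sumr_const card_ord.
rewrite -(mulr_natr (_ / _)) divfK ?gt_eqF //; congr (_ - _).
rewrite mxE; apply: eq_bigr => t _.
rewrite mxE !sampling_mx_mulE.
have h : 0 < l%:R * p (N t) by rewrite mulr_gt0.
rewrite mulrACA -expr2 exprVn sqr_sqrtr ?(ltW h) //; ring.
Qed.

(** Each entry of the error is a sum of [l] independent centred terms, whose
    variance is at most the second moment; sampling by leverage scores makes
    the second moments add up to a multiple of |W|_F^2. *)
Lemma sketched_product_error l k r c (p : 'I_k -> R) (beta : R)
    (Q : 'M[R]_(k, r)) (W : 'M[R]_(k, c)) :
  (0 < l)%N -> (0 < r)%N -> 0 < beta -> is_pos_distr p ->
  (forall i, beta * (\sum_a Q i a ^+ 2) / r%:R <= p i) ->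
  \sum_(N : draws l k) draws_prob p N *
    fnorm (Q^T *m (sampling_mx p N)^T *m sampling_mx p N *m W - Q^T *m W) ^+ 2
  <= r%:R / (beta * l%:R) * fnorm W ^+ 2.
Proof.
move=> l0 r0 beta0 [p0 p1] lev.
have l0' : 0 < l%:R :> R by rewrite ltr0n.
have r0' : 0 < r%:R :> R by rewrite ltr0n.
pose f a b i := Q i a * W i b / (l%:R * p i).
pose mu a b := (Q^T *m W) a b / l%:R.
have fmu a b : \sum_i p i * f a b i = mu a b.
  rewrite /mu mxE mulr_suml; apply: eq_bigr => i _.
  by rewrite /f mxE; field; rewrite !gt_eqF.
have entry a b :
    \sum_(N : draws l k) draws_prob p N * (\sum_t (f a b (N t) - mu a b)) ^+ 2
    <= l%:R * \sum_i p i * f a b i ^+ 2.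
  rewrite (@draws_variance l k p (fun i => f a b i - mu a b)) //; last first.
    under eq_bigr do rewrite mulrBr.
    by rewrite sumrB fmu -mulr_suml p1 mul1r subrr.
  rewrite ler_pM2l //.
  have -> : \sum_i p i * (f a b i - mu a b) ^+ 2 =
      \sum_i p i * f a b i ^+ 2 - mu a b ^+ 2.
    under eq_bigr => i _.
      have -> : p i * (f a b i - mu a b) ^+ 2 =
        p i * f a b i ^+ 2 - 2 * mu a b * (p i * f a b i) + mu a b ^+ 2 * p i by ring.
    over.
    rewrite big_split /= sumrB -!mulr_sumr fmu p1; ring.
  by rewrite gerBl sqr_ge0.
have -> : \sum_(N : draws l k) draws_prob p N *
    fnorm (Q^T *m (sampling_mx p N)^T *m sampling_mx p N *m W - Q^T *m W) ^+ 2 =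
    \sum_a \sum_b \sum_(N : draws l k)
      draws_prob p N * (\sum_t (f a b (N t) - mu a b)) ^+ 2.
  under [in RHS]eq_bigr => a _ do rewrite exchange_big.
  rewrite exchange_big /=; apply: eq_bigr => N _.
  rewrite sqr_fnormE mulr_sumr; apply: eq_bigr => a _.
  rewrite mulr_sumr; apply: eq_bigr => b _.
  by rewrite sketched_productE.
apply: (@le_trans _ _ (\sum_a \sum_b l%:R * \sum_i p i * f a b i ^+ 2)).
  by apply: ler_sum => a _; apply: ler_sum => b _.
have -> : \sum_a \sum_b l%:R * \sum_i p i * f a b i ^+ 2 =
    \sum_i \sum_b (\sum_a Q i a ^+ 2) / (l%:R * p i) * W i b ^+ 2.
  under eq_bigr do rewrite -mulr_sumr exchange_big.
  rewrite -mulr_sumr exchange_big /= mulr_sumr; apply: eq_bigr => i _.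
  rewrite exchange_big mulr_sumr; apply: eq_bigr => b _.
  rewrite !mulr_suml mulr_sumr; apply: eq_bigr => a _.
  by rewrite /f; field; rewrite !gt_eqF.
rewrite sqr_fnormE mulr_sumr; apply: ler_sum => i _.
rewrite mulr_sumr; apply: ler_sum => b _; apply: ler_wpM2r; first exact: sqr_ge0.
rewrite ler_pdivrMr ?mulr_gt0 //.
have := lev i; rewrite ler_pdivrMr // => h.
have -> : r%:R / (beta * l%:R) * (l%:R * p i) = p i * r%:R / beta.
  by field; rewrite !gt_eqF.
by rewrite ler_pdivlMr // mulrC.
Qed.

(** Markov's inequality, as a lower bound for the probability of success. *)
Lemma draws_markov l k (p : 'I_k -> R) (Phi : draws l k -> R) (P : pred (draws l k)) a x :
  is_pos_distr p -> 0 < a -> (forall N, 0 <= Phi N) ->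
  (forall N, Phi N <= a -> P N) ->
  \sum_N draws_prob p N * Phi N <= a * x ->
  1 - x <= \sum_(N | P N) draws_prob p N.
Proof.
move=> pd a0 Phi0 PP h; have [p0 p1] := pd.
rewrite -(sum_draws_prob l p1) (bigID P) /= -addrA gerDl subr_le0.
rewrite -(ler_pM2l a0); apply: le_trans h; rewrite mulr_sumr [leRHS](bigID P) /=.
rewrite ler_wpDl ?sumr_ge0 // => [N _|]; first by rewrite mulr_ge0 // draws_prob_ge0.
apply: ler_sum => N nP; have aP : a < Phi N.
  by rewrite ltNge; apply: contra nP; exact: PP.
by rewrite mulrC ler_wpM2l ?draws_prob_ge0 // ltW.
Qed.

End Sampling.

(** * A half iteration *)

Section HalfStep.
Variable R : realType.

(** The three errors needed by the perturbation bound are blocks of the error of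
    the product with [W], whose squared Frobenius norm is 2 r + 1 <= 3 r.  Its
    mean square error is thus at most 3 eps^2 xi^4 / 1296, which is at most xi
    times the square of eps / 108 because 27 xi^3 <= 1.  The matrix [X N] is
    the pseudoinverse of [S A] in a row step, and the transpose of that of [A^T S^T]
    in a column step. *)
Lemma sampled_half_step k h r l (M : 'M[R]_(k, h)) U s V (A Q : 'M[R]_(k, r)) T
    (p : 'I_k -> R) (X : draws l k -> 'M[R]_(r, l)) (beta eps xi d d' : R) :
  is_svd M U s V -> (0 < r)%N -> 0 < s r.+1 -> s r.+1 <= 2^-1 * s r ->
  Q^T *m Q = 1%:M -> T \in unitmx -> A = Q *m T ->
  is_pos_distr p -> (forall i, beta * (\sum_a Q i a ^+ 2) / r%:R <= p i) ->
  0 < beta -> (0 < l)%N -> 0 < eps <= 1 -> 0 < xi <= 3^-1 ->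
  r%:R ^+ 2 / (beta * l%:R) <= eps ^+ 2 * xi ^+ 4 / 1296 ->
  range_near A (top_cols r U) d ->
  eps * (fnorm (M - truncation r U s V) / s r.+1) <= d -> d <= 2^-1 ->
  87 / 100 * d <= d' ->
  (forall N, let W := sampling_mx p N *m A in
     W^T *m W \in unitmx -> is_pseudoinverse W (X N)) ->
  1 - xi <= \sum_(N : draws l k |
    `[< range_near (X N *m (sampling_mx p N *m M))^T (top_cols r V) d' >])
      draws_prob p N.
Proof.
move=> Msvd r0 sp s2 QQ Tu AE pd lev b0 l0 /andP[e0 e1] /andP[x0 x3] lbig AU dlow d2 dd' XP.
have [[UU VV ME] [s0 sd sz]] := Msvd.
have rkh : (r < minn k h)%N.
  by rewrite ltnNge; apply/negP => hr; move: sp; rewrite sz ?ltnS // ltxx.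
have [rk rh] : (r <= k)%N /\ (r <= h)%N.
  by move: rkh; rewrite leq_min => /andP[? ?]; split; apply: ltnW.
set E := M - truncation r U s V in dlow.
set U1 := top_cols r U in AU *; set V1 := top_cols r V.
have U1o : U1^T *m U1 = 1%:M by exact: tr_top_cols.
have V1o : V1^T *m V1 = 1%:M by exact: tr_top_cols.
have tE : s r.+1 <= fnorm E by exact: (sing_val_le_residual Msvd).
have Ep : 0 < fnorm E := lt_le_trans sp tE.
have r1 : 1 <= r%:R :> R by rewrite ler1n.
have d0 : 0 <= d.
  by apply: le_trans dlow; rewrite mulr_ge0 ?divr_ge0 ?fnorm_ge0 ?ltW.
have EV : E *m V1 = 0.
  have := tr_top_cols_residual r (is_svd_tr Msvd); rewrite -(tr_truncation _ U).
  rewrite -linearB /= -/E -/V1 -trmx_mul => /(congr1 trmx).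
  by rewrite trmxK trmx0.
pose W := row_mx Q (row_mx U1 ((fnorm E)^-1 *: E)).
have WF : fnorm W ^+ 2 = r%:R + (r%:R + 1).
  rewrite !sqr_fnorm_row_mx (sqr_fnorm_isom QQ) (sqr_fnorm_isom U1o) fnormZ.
  rewrite ger0_norm ?invr_ge0 ?fnorm_ge0 //.
  by rewrite mulVf ?gt_eqF // expr1n.
pose Phi (N : draws l k) :=
  fnorm (Q^T *m (sampling_mx p N)^T *m sampling_mx p N *m W - Q^T *m W) ^+ 2.
apply: (@draws_markov R l k p Phi _ ((eps / 108) ^+ 2)) => //.
- by rewrite exprn_gt0 // divr_gt0.
- by move=> N; rewrite sqr_ge0.
- have e108 : 0 <= eps / 108 by rewrite divr_ge0 ?ltW.
  move=> N; rewrite /Phi -(fnorm_le_sqr _ e108).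
  set S := sampling_mx p N; set Y := Q^T *m S^T *m S => small.
  have YW : Y *m W - Q^T *m W = row_mx (Y *m Q - 1%:M)
      (row_mx (Y *m U1 - Q^T *m U1) ((fnorm E)^-1 *: (Y *m E - Q^T *m E))).
    rewrite /W !mul_mx_row QQ opp_row_mx add_row_mx opp_row_mx add_row_mx.
    by rewrite -!scalemxAr -scalerBr.
  have fle c1 c2 (B : 'M[R]_(r, c1)) (C : 'M[R]_(r, c2)) x : 0 <= x ->
      fnorm (row_mx B C) <= x -> fnorm B <= x /\ fnorm C <= x.
    move=> xx; rewrite !fnorm_le_sqr // sqr_fnorm_row_mx => bc.
    by split; apply: le_trans bc; rewrite ?lerDl ?lerDr sqr_ge0.
  have e100 : eps / 108 <= 100^-1 by lra.
  move: small; rewrite YW => /(fle _ _ _ _ _ e108)[YQ] /(fle _ _ _ _ _ e108)[YU].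
  rewrite fnormZ ger0_norm ?invr_ge0 ?fnorm_ge0 // mulrC ler_pdivrMr // => YE.
  have Gu : Y *m Q \in unitmx.
    apply: (@lower_bound_unit R r _ (99 / 100)) => // x.
    have -> : Y *m Q *m x = x + (Y *m Q - 1%:M) *m x.
      by rewrite mulmxBl mul1mx addrC subrK.
    apply: le_trans (ler_fnormB _ _).
    have := opnorm_le_weaken (le_trans YQ e100) (opnorm_le_fnorm _) x; lra.
  have SAu : (S *m A)^T *m (S *m A) \in unitmx.
    have -> : (S *m A)^T *m (S *m A) = T^T *m (Y *m Q) *m T.
      by rewrite AE /Y !trmx_mul !mulmxA.
    by rewrite !unitmx_mul unitmx_tr Tu Gu.
  have := XP N SAu; rewrite /= -/S AE => /(sketched_solution M Tu Gu)[L Lu ->].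
  apply/asboolP; rewrite trmx_mul; apply: (near_le dd'); apply: near_mulr.
    by rewrite unitmx_tr.
  rewrite -/Y.
  have -> : M = U1 *m diag_mx (\row_(j < r) s j.+1) *m V1^T + E.
    by rewrite -truncationE addrC subrK.
  apply: (@near_perturbed R k h r U1 Q V1 _ E Y (s r.+1) (s r)) => //.
  + exact: (tr_top_cols_residual r Msvd).
  + exact: (opnorm_le_residual r Msvd).
  + by rewrite tr_diag_mx.
  + exact: (sing_val_lower Msvd).
  + by lra.
  + by apply/andP.
  + exact: (near_proj QQ AE AU).
  + exact: le_trans e100.
  + apply: le_trans YE _.
    have : eps * fnorm E <= s r.+1 * d.
      by rewrite mulrA ler_pdivrMr // in dlow; rewrite (mulrC _ d).
    by have := mulr_gt0 e0 Ep; lra.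
- have := @sketched_product_error R l k r _ p beta Q W l0 r0 b0 pd lev.
  move/le_trans; apply; rewrite WF.
  have -> : r%:R / (beta * l%:R) * (r%:R + (r%:R + 1)) =
      r%:R ^+ 2 / (beta * l%:R) * (2 + r%:R^-1) :> R.
    by field; rewrite !gt_eqF ?ltr0n // (lt_le_trans _ r1).
  apply: (@le_trans _ _ (eps ^+ 2 * xi ^+ 4 / 1296 * 3)).
    apply: ler_pM => //.
    - by apply: divr_ge0; [exact: sqr_ge0 | apply: mulr_ge0; [exact: ltW | exact: ler0n]].
    - have : r%:R^-1 <= 1 :> R by rewrite invf_le1 ?ltr0n.
      by lra.
  have -> : eps ^+ 2 * xi ^+ 4 / 1296 * 3 = (eps / 108) ^+ 2 * xi * (27 * xi ^+ 3).
    by field.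
  apply: ler_piMr; first by apply: mulr_ge0; [exact: sqr_ge0 | exact: ltW].
  have -> : 27 * xi ^+ 3 = (3 * xi) ^+ 3 by ring.
  by apply: exprn_ile1; lra.
Qed.

End HalfStep.

(** * Runs of the algorithm *)

Section Runs.
Variables (R : realType) (m n l : nat).
Variable rowp : seq (round m n l) -> 'I_m -> R.
Variable colp : seq (round m n l) -> draws l m -> 'I_n -> R.

Lemma big_tuple_cons (T : finType) t (P : pred (seq T)) (F : seq T -> R) :
  \sum_(w : t.+1.-tuple T | P w) F w =
  \sum_(h : t.-tuple T) \sum_(a | P (a :: h)) F (a :: h).
Proof.
rewrite pair_big_dep /=.
rewrite (reindex (fun x : t.-tuple T * T => [tuple of x.2 :: x.1])) //=.
exists (fun w => (behead_tuple w, thead w)) => [[h a] _|w _] /=.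
  by congr (_, _); apply: val_inj.
by rewrite -tuple_eta.
Qed.

Lemma run_prob_ge0 tau (h : seq (round m n l)) :
  (forall h, (size h < tau)%N -> is_pos_distr (rowp h)) ->
  (forall h N, (size h < tau)%N -> is_pos_distr (colp h N)) ->
  (size h <= tau)%N -> 0 <= run_prob rowp colp h.
Proof.
move=> rd cd; elim: h => //= -[N N'] h IH sh.
rewrite !mulr_ge0 ?draws_prob_ge0 ?IH //; [exact: ltnW | exact: rd | exact: cd].
Qed.

(** The conditional probabilities of success of the 2 tau sampling steps multiply. *)
Lemma run_prob_chain (x : R) tau (P : pred (seq (round m n l)))
    (Rw : seq (round m n l) -> pred (draws l m))
    (Cl : seq (round m n l) -> draws l m -> pred (draws l n)) :
  0 <= x <= 2^-1 ->
  (forall h, (size h < tau)%N -> is_pos_distr (rowp h)) ->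
  (forall h N, (size h < tau)%N -> is_pos_distr (colp h N)) ->
  P [::] ->
  (forall h, (size h < tau)%N -> P h ->
    1 - x <= \sum_(N | Rw h N) draws_prob (rowp h) N) ->
  (forall h N, (size h < tau)%N -> P h -> Rw h N ->
    1 - x <= \sum_(N' | Cl h N N') draws_prob (colp h N) N') ->
  (forall h N N', P h -> Rw h N -> Cl h N N' -> P ((N, N') :: h)) ->
  1 - 2 * tau%:R * x <= \sum_(w : tau.-tuple (round m n l) | P w) run_prob rowp colp w.
Proof.
move=> /andP[x0 x2] rd cd P0 PR PC PS.
have run_ge0 h : (size h <= tau)%N -> 0 <= run_prob rowp colp h.
  exact: run_prob_ge0.
(* The bound is kept multiplicative, with (1 - x)^2 >= 1 - 2 x for each round,
   and compared with the linear one at the end. *)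
suff : forall t, (t <= tau)%N -> (1 - 2 * x) ^+ t <=
    \sum_(w : t.-tuple (round m n l) | P w) run_prob rowp colp w.
  move=> /(_ tau (leqnn _)); apply: le_trans.
  elim: (tau) => [|t IH]; first by rewrite mulr0 mul0r subr0 expr0.
  rewrite exprS; apply: (@le_trans _ _ ((1 - 2 * x) * (1 - 2 * t%:R * x))).
    rewrite -natr1; have := mulr_ge0 (ler0n R t) (sqr_ge0 x); nra.
  by rewrite ler_wpM2l //; lra.
elim=> [|t IH] tt.
  rewrite expr0 (bigD1 [tuple]) //= lerDl sumr_ge0 // => w _.
  by rewrite run_ge0 // size_tuple.
rewrite big_tuple_cons exprSr; apply: (@le_trans _ _
  (\sum_(w : t.-tuple (round m n l) | P w) run_prob rowp colp w * (1 - 2 * x))).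
  by rewrite -mulr_suml ler_wpM2r ?IH //; [lra | exact: ltnW].
rewrite [leRHS](bigID (fun w : t.-tuple _ => P w)) /= ler_wpDr //.
  apply: sumr_ge0 => w _; apply: sumr_ge0 => a _.
  by rewrite (run_ge0 (a :: w)) //= size_tuple.
apply: ler_sum => w Pw; have sw : (size w < tau)%N by rewrite size_tuple.
have rw0 : 0 <= run_prob rowp colp w by rewrite run_ge0 // ltnW.
apply: (@le_trans _ _ (\sum_(N | Rw w N) \sum_(N' | Cl w N N')
    run_prob rowp colp w * draws_prob (rowp w) N * draws_prob (colp w N) N')).
  apply: (@le_trans _ _ (\sum_(N | Rw w N)
      run_prob rowp colp w * draws_prob (rowp w) N * (1 - x))).
    rewrite -mulr_suml -mulr_sumr -mulrA ler_wpM2l //.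
    apply: (@le_trans _ _ ((1 - x) * (1 - x))); first by nra.
    by rewrite ler_wpM2r ?PR //; lra.
  apply: ler_sum => N RN; rewrite -mulr_sumr ler_wpM2l ?PC //.
  by rewrite mulr_ge0 // draws_prob_ge0 //; exact: rd.
rewrite pair_big_dep /= [leRHS](bigID (fun a : round m n l => Rw w a.1 && Cl w a.1 a.2)) /=.
rewrite ler_wpDr //.
  by apply: sumr_ge0 => a _; rewrite (run_ge0 (a :: w)) //= size_tuple.
rewrite le_eqVlt; apply/orP; left; apply/eqP; apply: eq_bigl => -[N N'] /=.
by apply/idP/andP => [/andP[RN CN]|[]//]; split; rewrite ?RN //; apply: PS.
Qed.

End Runs.

(** * Choice of the constants *)

Section Constants.
Variable R : realType.

Lemma sample_size_bound (r l : nat) (beta eps xi : R) :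
  (0 < r)%N -> 0 < beta -> 0 < eps -> 0 < xi ->
  l%:Z = Num.ceil (1296 * beta^-1 * r%:R ^+ 2 * eps ^- 2 * xi ^- 4) ->
  (0 < l)%N /\ r%:R ^+ 2 / (beta * l%:R) <= eps ^+ 2 * xi ^+ 4 / 1296.
Proof.
move=> r0 b0 heps0 x0; set C := (X in Num.ceil X) => hl.
have r0' : 0 < r%:R :> R by rewrite ltr0n.
have C0 : 0 < C.
  apply: mulr_gt0; last by rewrite invr_gt0 exprn_gt0.
  apply: mulr_gt0; last by rewrite invr_gt0 exprn_gt0.
  apply: mulr_gt0; last by rewrite exprn_gt0.
  by apply: mulr_gt0; [lra | rewrite invr_gt0].
have lC : C <= l%:R.
  by have := ceil_ge C; rewrite -hl -pmulrn.
have l0' : 0 < l%:R :> R by exact: lt_le_trans lC.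
split; first by rewrite -(ltr0n R).
rewrite ler_pdivrMr ?mulr_gt0 //.
have -> : r%:R ^+ 2 = eps ^+ 2 * xi ^+ 4 / 1296 * (beta * C) :> R.
  by rewrite /C; field; rewrite !gt_eqF.
apply: ler_wpM2l; last by apply: ler_wpM2l; first exact: ltW.
apply: mulr_ge0; last by rewrite invr_ge0; lra.
by apply: mulr_ge0; apply: exprn_ge0; exact: ltW.
Qed.

Lemma iteration_count_bound (tau : nat) (x : R) : 0 < x ->
  tau%:Z = Num.ceil (2^-1 * (ln x / ln (87 / 100))) ->
  (87 / 100) ^+ (2 * tau) <= x.
Proof.
move=> x0 htau; have q0 : 0 < 87 / 100 :> R by lra.
have lq : ln (87 / 100) < 0 :> R by apply: ln_lt0; lra.
rewrite -ler_ln ?posrE ?exprn_gt0 // lnXn // -(mulr_natl (ln _)) natrM.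
have := ceil_ge (2^-1 * (ln x / ln (87 / 100))); rewrite -htau -pmulrn => ht.
have {}ht : ln x / ln (87 / 100) <= 2 * tau%:R by lra.
by rewrite ler_ndivrMr in ht.
Qed.

(** An upper bound for the distance after [k] half iterations: it contracts by the
    factor 0.87 until it reaches the level [floor] of the sampling error. *)
Definition schedule (floor : R) (k : nat) : R := Num.max ((87 / 100) ^+ k / 2) floor.

Lemma schedule_le_half floor k : floor <= 2^-1 -> schedule floor k <= 2^-1.
Proof.
move=> f2; rewrite ge_max f2 andbT.
have : (87 / 100) ^+ k <= 1 :> R by apply: exprn_ile1; lra.
lra.
Qed.

Lemma schedule_ge floor k : floor <= schedule floor k.
Proof. by rewrite le_max lexx orbT. Qed.

Lemma schedule_succ floor k :
  0 <= floor -> 87 / 100 * schedule floor k <= schedule floor k.+1.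
Proof.
move=> f0; rewrite /schedule maxr_pMr; last by lra.
rewrite ge_max !le_max exprS mulrA lexx /=.
by apply/orP; right; lra.
Qed.

End Constants.

(** * The algorithm *)

Theorem theorem5p2 (R : realType) (m n r l tau : nat)
    (M : 'M[R]_(m, n)) (U : 'M[R]_m) (V : 'M[R]_n) (A0 : 'M[R]_(m, r))
    (theta eps xi beta : R)
    (rowp : seq (round m n l) -> 'I_m -> R)
    (colp : seq (round m n l) -> draws l m -> 'I_n -> R)
    (hr : (1 <= r <= minn m n)%N)
    (hsvd : is_svd M U (sing_val M) V)
    (hgap : sing_val M r.+1 < sing_val M r)
    (hpos : 0 < sing_val M r.+1)
    (hratio : sing_val M r.+1 / sing_val M r <= 2^-1)
    (hA0 : Dist A0 (top_cols r U) <= 2^-1)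
    (htheta : theta =
       fnorm (M - truncation r U (sing_val M) V) / sing_val M r.+1)
    (hxi : 0 < xi < 3^-1)
    (heps0 : 0 < eps) (heps : eps <= (8 * theta) ^- 2)
    (hbeta : 0 < beta <= 1)
    (hl : l%:Z = Num.ceil (1296 * beta^-1 * r%:R ^+ 2 * eps ^- 2 * xi ^- 4))
    (hlmn : (l <= minn m n)%N)
    (htau : tau%:Z = Num.ceil (2^-1 * (ln (8 * theta * eps) / ln (87 / 100))))
    (hadm : admissible M A0 rowp colp tau beta) :
  1 - 2 * tau%:R * xi <=
    prob_output M A0 rowp colp tau
      (fun A => Dist A (top_cols r U) <= 4 * theta * Num.sqrt eps).
Proof.
have /andP[r0 rmn] := hr; have /andP[x0 x3] := hxi; have /andP[b0 b1] := hbeta.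
have [rm rn] : (r <= m)%N /\ (r <= n)%N by move: rmn; rewrite leq_min => /andP.
set s := sing_val M in hsvd hgap hpos hratio htheta.
have sr0 : 0 < s r by exact: lt_trans hgap.
have s2 : s r.+1 <= 2^-1 * s r by rewrite -ler_pdivrMr.
have [[UU VV ME] [sn0 sd sz]] := hsvd.
have rmn1 : (r < minn m n)%N.
  by rewrite ltnNge; apply/negP => h; move: hpos; rewrite sz ?ltnS // ltxx.
have th1 : 1 <= theta.
  by rewrite htheta ler_pdivlMr // mul1r (sing_val_le_residual hsvd).
have eth : eps * theta <= 64^-1.
  have : eps * (8 * theta) ^+ 2 <= 1 by rewrite -ler_pdivlMr ?exprn_gt0 //; lra.
  have := ltW heps0; nra.
have eps64 : eps <= 64^-1 by apply: le_trans eth; rewrite ler_peMr // ltW.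
have [l0 lbig] := sample_size_bound r0 b0 heps0 x0 hl.
set U1 := top_cols r U in hA0 *; set V1 := top_cols r V.
have U1o : U1^T *m U1 = 1%:M by exact: tr_top_cols.
have et0 : 0 < eps * theta by rewrite mulr_gt0 // (lt_le_trans ltr01).
have et0' := ltW et0.
have eps1 : eps <= 1 by apply: le_trans eps64 _; rewrite invf_le1 ?ltr0n // ler1n.
pose d := schedule (eps * theta).
have d2 k : d k <= 2^-1.
  by apply/schedule_le_half/(le_trans eth); rewrite lef_pV2 ?posrE ?ler_nat ?ltr0n.
have dlow k : eps * theta <= d k := schedule_ge _ _.
have dS k : 87 / 100 * d k <= d k.+1 := schedule_succ _ et0'.
pose nearA h := `[< range_near (iter_A M A0 rowp colp h) U1 (d (2 * size h)%N) >].
pose nearB h N := `[< range_near (iter_B M A0 rowp colp h N)^T V1 (d (2 * size h).+1) >].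
pose nearA' h N N' := `[< range_near (next_A M colp h N (iter_B M A0 rowp colp h N) N')
  U1 (d (2 * (size h).+1)%N) >].
(* [no_failure] of a history says nothing about the rank of its last matrix,
   hence the second conjunct carries the rank to the next round. *)
pose P h := no_failure M A0 rowp colp h && nearA h.
have rd h : (size h < tau)%N -> is_pos_distr (rowp h) by case/hadm.
have cd h N : (size h < tau)%N -> is_pos_distr (colp h N).
  by case/hadm => _ _ /(_ N)[].
have fin : (87 / 100) ^+ (2 * tau) <= 8 * theta * eps.
  by apply: iteration_count_bound htau; rewrite -mulrA (mulrC theta) mulr_gt0 // ltr0n.
have final w : size w = tau -> P w ->
    no_failure M A0 rowp colp w &&
      (Dist (iter_A M A0 rowp colp w) U1 <= 4 * theta * Num.sqrt eps).
  move=> sw /andP[-> /asboolP nw] /=.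
  have e4 : d (2 * tau)%N <= 4 * theta * Num.sqrt eps.
    have es : eps <= Num.sqrt eps.
      rewrite -{1}(sqr_sqrtr (ltW heps0)) expr2 ler_piMl ?sqrtr_ge0 //.
      by rewrite -sqrtr1 ler_wsqrtr //; lra.
    apply: (@le_trans _ _ (4 * theta * eps)).
      by rewrite ge_max; apply/andP; split; [lra | nra].
    by rewrite ler_wpM2l //; lra.
  apply: le_trans e4; apply: near_Dist => //; last by rewrite -sw.
  by apply: le_trans (dlow _); exact: ltW.
rewrite /prob_output.
apply: (@le_trans _ _ (\sum_(w : tau.-tuple (round m n l) | P w) run_prob rowp colp w)).
  apply: (@run_prob_chain R m n l rowp colp xi tau P nearB nearA') => //.
  - by apply/andP; split; [exact: ltW | lra].
  - apply/andP; split=> //; apply/asboolP => /=.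
    apply: (@near_le _ _ _ _ _ 2^-1).
      by rewrite le_max muln0 expr0 mul1r lexx.
    by apply: Dist_near => //; lra.
  - move=> h sh /andP[nf /asboolP nA].
    have [rA _] := nA; have [QQ [T Tu AE]] := svd_full_col (svdP _) rA.
    have [pd lev _] := hadm h sh.
    apply: (sampled_half_step hsvd r0 hpos s2 QQ Tu AE pd
      (lev rA) b0 l0 _ _ lbig nA _ (d2 _)) => //.
    + by apply/andP.
    + by apply/andP; split=> //; exact: ltW.
    + by rewrite -htheta.
    + by move=> N; exact: pseudoinverse_full_col.
  - move=> h N sh _ /asboolP nB.
    have [rB' _] := nB; have rB : \rank (iter_B M A0 rowp colp h N) = r.
      by rewrite -mxrank_tr.
    have [QQ [T Tu BE]] := svd_full_col (is_svd_tr (svdP (iter_B M A0 rowp colp h N))) rB'.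
    have [_ _ /(_ N)[pd lev]] := hadm h sh.
    (* The column step is a row step for [M^T], starting from [B^T]. *)
    pose B := iter_B M A0 rowp colp h N.
    pose X (N' : draws l n) := (pseudoinverse (B *m (sampling_mx (colp h N) N')^T))^T.
    have AX N' : next_A M colp h N B N' =
        (X N' *m (sampling_mx (colp h N) N' *m M^T))^T.
      by rewrite [RHS]trmx_mul [(_ *m M^T)^T]trmx_mul (trmxK M) [(X _)^T]trmxK.
    rewrite /nearA' -/B; under eq_bigl => N' do rewrite AX.
    have hsvd' := is_svd_tr hsvd.
    apply: (sampled_half_step hsvd' r0 hpos s2 QQ Tu BE pd
      (lev rB) b0 l0 _ _ lbig nB _ (d2 _)) => //.
    + by apply/andP.
    + by apply/andP; split=> //; exact: ltW.
    + by rewrite -(tr_truncation _ U) -linearB /= fnorm_tr -htheta.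
    + by rewrite mulnS; exact: dS.
    + move=> N' W; have -> : W = (B *m (sampling_mx (colp h N) N')^T)^T.
        by rewrite trmx_mul [(sampling_mx _ _)^T^T]trmxK.
      rewrite trmxK => Wu; exact/is_pseudoinverse_tr/pseudoinverse_full_row.
  - move=> h N N' /andP[nf /asboolP[rA _]] /asboolP[rB _] nA'; apply/andP; split=> //.
    by rewrite /= nf rA eqxx -[X in _ == X]rB mxrank_tr eqxx.
rewrite [leRHS](bigID (fun w : tau.-tuple _ => P w)) /= ler_wpDr //.
  by apply: sumr_ge0 => w _; rewrite (@run_prob_ge0 _ _ _ _ _ _ tau) // size_tuple.
rewrite le_eqVlt; apply/orP; left; apply/eqP; apply: eq_bigl => w.
by apply/idP/andP => [Pw|[]//]; split=> //; apply: final; rewrite ?size_tuple.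
Qed.
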